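(* Let $g\ge0$ and $d>0$ be integers, let $\lambda,\mu$ be partitions of $d$, put $r=l(\lambda)+l(\mu)+2g-2$, and assume $r>0$ and $\{\lambda,\mu\}\not\subset\{(2k),(k,k)\}$ for every $k\geq 1$. If $l(\lambda_0,\mu_0)\le 2$ and $(\lambda_{o,o},\mu_{o,o})\ne\emptyset$, then there exist zigzag covers of genus $g$ and type $(\lambda,\mu)$, i.e. $Z_g(\lambda,\mu)>0$.
   Context: Partitions. $l(\cdot)$ is the number of parts; $(\lambda,\mu)$ denotes concatenation; $2\lambda$ doubles every part; $\lambda^2=(\lambda_1,\lambda_1,\dots,\lambda_n,\lambda_n)$. A partition is even (odd) if all its parts are even (odd). Every partition decomposes uniquely as $\lambda=(2\lambda_{2e},2\lambda_{2o},\lambda_{o,o}^2,\lambda_0)$ with $\lambda_{2e}$ even, $\lambda_{2o}$ and $\lambda_{o,o}$ odd, and $\lambda_0$ odd without repeated entries (tail decomposition). Tropical covers. A graph is a finite connected graph without two-valent vertices (multiple edges allowed). One-valent vertices are called ends, other vertices inner vertices; edges adjacent to an end are leaves, other edges are inner edges. $C^\circ$ is $C$ minus its ends. A tropical curve $C$ is a graph with a length $l(e)\in(0,\infty)$ for each inner edge; this gives a complete inner metric on $C^\circ$ with inner edges isometric to $[0,l(e)]$ and leaves (without their end) isometric to $[0,\infty)$. Its genus is its first Betti number. $\mathbf{TP}^1=\mathbf R\cup\{\pm\infty\}$ is the curve consisting of one edge, with inner part isometric to $\mathbf R$. A piecewise $\mathbf Z$-linear map $\varphi:C\to D$ is a continuous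 map such that for each edge $e$ there is an integer $\omega(e)\geq 0$ (the weight) with $\mathrm{dist}(\varphi(x),\varphi(y))=\omega(e)\,\mathrm{dist}(x,y)$ for all $x,y\in e\cap C^\circ$. After subdividing so that every edge maps to a vertex or an edge, $\varphi$ is a tropical morphism if for every vertex $x$ of $C$ the sum of $\omega(e)$ over edges $e\ni x$ with $\varphi(e)=e'$ is the same for all edges $e'\ni\varphi(x)$ of $D$; its degree is the sum of $\omega(e)$ over all edges $e$ with $\varphi(e)=e'$, which does not depend on $e'$. Fix $r$ distinct points $\mathcal P\subset\mathbf R$. A tropical cover of genus $g$, type $(\lambda,\mu)$, simply branched at $\mathcal P$ is a degree $d$ tropical morphism $\varphi:C\to\mathbf{TP}^1$ with $C$ of genus $g$, $\varphi^{-1}(\mathbf R)=C^\circ$, such that the weights of the leaves mapping to $-\infty$ (resp. $+\infty$) at their ends form $\lambda$ (resp. $\mu$), and such that each point of $\mathcal P$ is the image of an inner vertex of $C$. (Then $C$ is three-valent, $\varphi$ is non-constant on every edge, and there is exactly one inner vertex over each point of $\mathcal P$ and no others.) An isomorphism of tropical covers is an isometry of the sources (bijective piecewise $\mathbf Z$-linear with piecewise $\mathbf Z$-linear inverse) commuting with the maps to $\mathbf{TP}^1$. Zigzag covers. Edges are even or odd according to their weight. A symmetric cycle (resp. symmetric fork) is a pair of inner edges sharing both endpoints (resp. a pair of leaves sharing their inner vertex) having equal weights and the same image under $\varphi$; its weight is the weight of one of its edges. A string in $C$ is a connected subgraph $S$ such that $S\cap C^\circ$ is a closed one-dimensional submanifold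 of $C^\circ$, i.e. $S$ is a simple loop or a simple path joining two ends. A tropical cover is a zigzag cover if there is a subset $S\subset C$, containing no edge of a symmetric cycle or of a symmetric fork of odd weight, such that $S$ is a string of odd edges or a single inner vertex, and each connected component of $C\setminus S$ is a tail of one of these forms: (i) a chain of even edges, starting at a vertex of $S$, in which consecutive even edges are joined by a symmetric cycle of odd weight (any number of cycles, including zero), the last even edge ending in a symmetric fork of odd weight; (ii) such a chain (any number of symmetric cycles of odd weight, including zero) whose last even edge is a leaf of weight twice an odd number; (iii) a single leaf of even weight, without cycles or forks. The zigzag number $Z_g(\lambda,\mu)$ is the number of isomorphism classes of zigzag covers of genus $g$, type $(\lambda,\mu)$, simply branched at $\mathcal P$; it does not depend on the choice of $\mathcal P$. *)

(* Defs.v *)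
From mathcomp Require Import all_boot all_order all_algebra.
From mathcomp Require Import all_classical all_reals all_analysis.
From mathcomp Require Import zify.

Set Implicit Arguments.
Unset Strict Implicit.
Unset Printing Implicit Defensive.

Import Order.TTheory GRing.Theory Num.Theory.
Import numFieldNormedType.Exports.

Local Open Scope ring_scope.

Definition int_partition (s : seq nat) : bool :=
  sorted geq s && (0 \notin s)%N.

Definition partition_of (d : nat) (s : seq nat) : bool :=
  int_partition s && (sumn s == d).

Definition part_double (s : seq nat) : seq nat := [seq k.*2 | k <- s].

Definition part_square (s : seq nat) : seq nat :=
  flatten [seq [:: k; k] | k <- s].

(* Concatenations of partitions are compared up to reordering of the parts. *)
Record tail_decomposition (s s2e s2o soo s0 : seq nat) : Prop := {
  td_partitions :
    [&& int_partition s2e, int_partition s2o, int_partition soo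
      & int_partition s0];
  td_s2e_even : all (fun k => ~~ odd k) s2e;
  td_s2o_odd : all odd s2o;
  td_soo_odd : all odd soo;
  td_s0_odd : all odd s0;
  td_s0_uniq : uniq s0;
  td_concat :
    perm_eq s (part_double s2e ++ part_double s2o ++ part_square soo ++ s0)
}.

(* An edge [e] runs from [endpt e false] to [endpt e true]; this auxiliary
   orientation carries no meaning.  A pair [(e, b)] is a half-edge at
   [endpt e b]. *)
Record multigraph := Multigraph {
  vert : finType;
  edge : finType;
  endpt : edge -> bool -> vert
}.

Section Graphs.
Variable G : multigraph.
Implicit Types (u v w : vert G) (e : edge G).

Definition valence v : nat :=
  #|[set h : edge G * bool | endpt h.1 h.2 == v]|.

Definition is_end v : bool := valence v == 1.

Definition is_inner v : bool := ~~ is_end v.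

Definition is_leaf e : bool := is_end (endpt e false) || is_end (endpt e true).

Definition joins e u v : bool :=
  [exists b, (endpt e b == u) && (endpt e (~~ b) == v)].

Definition graph_connected : Prop :=
  (0 < #|vert G|)%N /\ forall u v, connect (fun x y => [exists e, joins e x y]) u v.

(* The left kernel is the first homology group with rational coefficients. *)
Definition boundary_mx : 'M[rat]_(#|edge G|, #|vert G|) :=
  \matrix_(i, j) ((endpt (enum_val i) true == enum_val j)%:R
                  - (endpt (enum_val i) false == enum_val j)%:R).

Definition betti1 : nat := \rank (kermx boundary_mx).

Lemma row_boundary_mx (f : 'rV[rat]_#|vert G|) e :
  (f *m boundary_mx^T) 0 (enum_rank e) =
    f 0 (enum_rank (endpt e true)) - f 0 (enum_rank (endpt e false)).
Proof.
have sumf v : \sum_j f 0 j * (v == enum_val j)%:R = f 0 (enum_rank v).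
  rewrite (bigD1 (enum_rank v)) //= enum_rankK eqxx mulr1.
  rewrite big1 ?addr0 // => j jv; case: eqP => [vj|_]; last by rewrite mulr0.
  by move: jv; rewrite vj enum_valK eqxx.
rewrite -!sumf -sumrB mxE; apply: eq_bigr => j _.
by rewrite !mxE enum_rankK mulrBr.
Qed.

Lemma betti1E : graph_connected -> (betti1 + #|vert G| = #|edge G| + 1)%N.
Proof.
case=> V_gt0 Gconn; rewrite /betti1 mxrank_ker.
have rkK : \rank (kermx boundary_mx^T) = 1%N.
  pose J : 'rV[rat]_#|vert G| := const_mx 1.
  have JK : (J <= kermx boundary_mx^T)%MS.
    apply/sub_kermxP/rowP=> i.
    by rewrite -[i]enum_valK row_boundary_mx !mxE subrr.
  have KJ : (kermx boundary_mx^T <= J)%MS.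
    apply/row_subP=> i; set f := row i _.
    have /sub_kermxP fD : (f <= kermx boundary_mx^T)%MS by exact: row_sub.
    have fe e : f 0 (enum_rank (endpt e true)) = f 0 (enum_rank (endpt e false)).
      by apply/eqP; rewrite -subr_eq0 -row_boundary_mx fD mxE.
    have fuv u v : f 0 (enum_rank u) = f 0 (enum_rank v).
      have /connectP[p] := Gconn u v.
      elim: p u => [|w p IHp] u /=; first by move=> _ ->.
      case/andP=> /existsP[e /existsP[b /andP[/eqP <- /eqP <-]]] pp lp.
      by rewrite -(IHp _ pp lp); case: (b); rewrite fe.
    suff -> : f = f 0 (Ordinal V_gt0) *: J by rewrite scalemx_sub.
    apply/rowP=> j; rewrite [RHS]mxE [J _ _]mxE mulr1.
    by rewrite -[j]enum_valK -[Ordinal _]enum_valK.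
  apply/eqP; rewrite eqn_leq; apply/andP; split.
    by rewrite (leq_trans (mxrankS KJ)) // rank_leq_row.
  rewrite -[1%N](_ : \rank J = 1%N) ?mxrankS //.
  rewrite rank_rV; case: eqP => // /rowP /(_ (Ordinal V_gt0)).
  by rewrite !mxE => /eqP; rewrite oner_eq0.
have := mxrank_ker boundary_mx^T; rewrite rkK mxrank_tr => rkD.
have := rank_leq_row boundary_mx; lia.
Qed.

End Graphs.

Record tropical_curve (R : realType) := TropicalCurve {
  graph :> multigraph;
  len : edge graph -> R;
  curve_connected : graph_connected graph;
  curve_no_two_valent : forall v : vert graph, valence v != 2;
  len_gt0 : forall e, ~~ is_leaf e -> 0 < len e
}.

Section Curves.
Variables (R : realType) (C : tropical_curve R).
Implicit Types (v : vert C) (e : edge C) (b : bool).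

(* The edge [e], without its ends, is parametrized isometrically by
   [edge_dom e]: its inner endpoints sit at [edge_coord e b], and an end is at
   infinite distance.  This gives [0, len e] for an inner edge and a half-line
   for a leaf, whose length has no meaning. *)
Definition edge_coord e b : R := if b then len e else 0.

Definition edge_dom e : set R :=
  [set t | (is_inner (endpt e false) -> 0 <= t) /\
           (is_inner (endpt e true) -> t <= len e)]%classic.

End Curves.

(* Maps from a tropical curve to [R] with both infinities added such that
   exactly the ends are sent to infinity, as [vmap] on the vertices and, in
   the coordinate of [edge_dom e], as [emap e] on the edge [e]. *)
Record plmap (R : realType) := PLMap {
  source :> tropical_curve R;
  vmap : vert source -> \bar R;
  emap : edge source -> R -> R;
  weight : edge source -> nat;
  vmap_fin_num : forall v, (vmap v \is a fin_num) = is_inner v;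
  emap_inner : forall e b, is_inner (endpt e b) ->
    (emap e (edge_coord e b))%:E = vmap (endpt e b);
  emap_end_false : forall e, is_end (endpt e false) ->
    ((emap e t)%:E @[t --> -oo] --> vmap (endpt e false))%classic;
  emap_end_true : forall e, is_end (endpt e true) ->
    ((emap e t)%:E @[t --> +oo] --> vmap (endpt e true))%classic;
  emap_dist : forall e s t, edge_dom e s -> edge_dom e t ->
    `|emap e s - emap e t| = (weight e)%:R * `|s - t|
}.

Section Covers.
Variables (R : realType) (phi : plmap R).
Implicit Types (v : vert phi) (e : edge phi) (b : bool) (y : R).

Definition edge_image e : set R := (emap e @` edge_dom e)%classic.

Definition rises e b : bool :=
  `[< forall t, edge_dom e t -> t != edge_coord e b ->
        emap e (edge_coord e b) < emap e t >].

Definition falls e b : bool :=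
  `[< forall t, edge_dom e t -> t != edge_coord e b ->
        emap e t < emap e (edge_coord e b) >].

(* At the points of the interior of an edge and at the ends, the condition is
   automatic. *)
Definition tropical_morphism : Prop :=
  forall v, is_inner v ->
    (\sum_(h : edge phi * bool | (endpt h.1 h.2 == v) && rises h.1 h.2)
        weight h.1 =
     \sum_(h : edge phi * bool | (endpt h.1 h.2 == v) && falls h.1 h.2)
        weight h.1)%N.

(* Points [y] that are not the image of a vertex represent the interiors of
   the edges of the subdivided target. *)
Definition has_degree (d : nat) : Prop :=
  forall y, (forall v, vmap v != y%:E) ->
    (\sum_(e | `[< edge_image e y >]) weight e)%N = d.

Definition leaf_weights (z : \bar R) : seq nat :=
  [seq weight e | e <- enum (edge phi) &
     [exists b, is_end (endpt e b) && (vmap (endpt e b) == z)]].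

Record tropical_cover (g d : nat) (lam mu : seq nat) (P : seq R) : Prop := {
  cover_morphism : tropical_morphism;
  cover_degree : has_degree d;
  cover_genus : betti1 phi = g;
  cover_type_neg : perm_eq (leaf_weights -oo%E) lam;
  cover_type_pos : perm_eq (leaf_weights +oo%E) mu;
  cover_branched : forall p, p \in P -> exists2 v : vert phi, is_inner v & vmap v = p%:E
}.

Definition symmetric_cycle e e' : Prop :=
  [/\ e != e', ~~ is_leaf e && ~~ is_leaf e',
      exists u v, joins e u v && joins e' u v,
      weight e = weight e' & edge_image e = edge_image e'].

Definition symmetric_fork e e' : Prop :=
  [/\ e != e', is_leaf e && is_leaf e',
      exists2 v, is_inner v &
        [exists b, endpt e b == v] && [exists b, endpt e' b == v],
      weight e = weight e' & edge_image e = edge_image e'].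

(* Subsets of the curve are unions of cells, i.e. of vertices and of open
   edges. *)
Definition cell : finType := (vert phi + edge phi)%type.

Definition vcell v : cell := inl v.
Definition ecell e : cell := inr e.

Definition cell_incident (x y : cell) : bool :=
  match x, y with
  | inl v, inr e | inr e, inl v => [exists b, endpt e b == v]
  | _, _ => false
  end.

Definition cell_step (A : {set cell}) : rel cell :=
  fun x x' => [&& x \in A, x' \in A & cell_incident x x'].

Definition cells_connected (A : {set cell}) : bool :=
  [forall x in A, forall x' in A, connect (cell_step A) x x'].

Definition cells_component (A : {set cell}) (x : cell) : {set cell} :=
  [set x' | connect (cell_step A) x x'].

Definition subgraph (S : {set cell}) : bool :=
  [forall e, (ecell e \in S) ==> [forall b, vcell (endpt e b) \in S]].

(* At each inner vertex of a string, exactly two of its half-edges meet; this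
   is what a one-dimensional submanifold of the curve without its ends means
   for a subgraph. *)
Definition is_string (S : {set cell}) : bool :=
  [&& subgraph S, cells_connected S, [exists e, ecell e \in S] &
      [forall v, is_inner v && (vcell v \in S) ==>
        (#|[set h : edge phi * bool |
             (endpt h.1 h.2 == v) && (ecell h.1 \in S)]| == 2)]].

(* [tail_chain v T]: the cells of [T] form a chain of even edges joined by
   symmetric cycles of odd weight and closed by a symmetric fork of odd weight
   or by a leaf of weight twice an odd number.  The starting vertex [v] is not
   counted in [T]; for a tail it belongs to the zigzag set. *)
Inductive tail_chain : vert phi -> {set cell} -> Prop :=
| tail_chain_fork v w e f f' x x' :
    joins e v w -> ~~ odd (weight e) ->
    symmetric_fork f f' -> odd (weight f) ->
    joins f w x -> is_end x -> joins f' w x' -> is_end x' ->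
    tail_chain v
      [set ecell e; vcell w; ecell f; vcell x; ecell f'; vcell x']
| tail_chain_leaf v w e :
    joins e v w -> is_end w ->
    (exists2 k, odd k & weight e = k.*2) ->
    tail_chain v [set ecell e; vcell w]
| tail_chain_cycle v w u e f f' T :
    joins e v w -> ~~ odd (weight e) ->
    symmetric_cycle f f' -> odd (weight f) ->
    joins f w u -> joins f' w u ->
    tail_chain u T ->
    [disjoint [set ecell e; vcell w; ecell f; ecell f'; vcell u] & T] ->
    tail_chain v
      ([set ecell e; vcell w; ecell f; ecell f'; vcell u] :|: T).

Definition even_leaf v (T : {set cell}) : Prop :=
  exists e w, [/\ joins e v w, is_end w, ~~ odd (weight e)
    & T = [set ecell e; vcell w]].

Definition is_tail (S T : {set cell}) : Prop :=
  exists2 v, vcell v \in S & tail_chain v T \/ even_leaf v T.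

Definition is_zigzag : Prop :=
  exists S : {set cell},
    [/\ forall e e', ecell e \in S ->
          ~ symmetric_cycle e e' /\ ~ (symmetric_fork e e' /\ odd (weight e)),
        (is_string S /\ forall e, ecell e \in S -> odd (weight e)) \/
          (exists2 v, is_inner v & S = [set vcell v])
      & forall x, x \notin S -> is_tail S (cells_component (~: S) x)].

Definition zigzag_cover g d lam mu P : Prop :=
  tropical_cover g d lam mu P /\ is_zigzag.

End Covers.

(* [fv], [fe] and [theta] describe the isometry on the vertices, on the set of
   edges and in the coordinates of each edge. *)
Definition cover_iso (R : realType) (phi psi : plmap R) : Prop :=
  exists (fv : vert phi -> vert psi) (fe : edge phi -> edge psi)
         (theta : edge phi -> R -> R),
  [/\ bijective fv /\ bijective fe,
      forall e, exists c : bool, forall b,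
        endpt (fe e) (b (+) c) = fv (endpt e b) /\
        (is_inner (endpt e b) -> theta e (edge_coord e b) = edge_coord (fe e) (b (+) c)),
      forall e, set_bij (edge_dom e) (edge_dom (fe e)) (theta e) /\
        {in edge_dom e &, forall s t, `|theta e s - theta e t| = `|s - t|},
      forall v, vmap (fv v) = vmap v
    & forall e t, edge_dom e t -> emap (fe e) (theta e t) = emap e t].

(* The number of isomorphism classes of zigzag covers, a priori possibly
   infinite, as the supremum of the sizes of the finite families of pairwise
   non-isomorphic zigzag covers. *)
Definition zigzag_number (R : realType) (g d : nat) (lam mu : seq nat)
    (P : seq R) : \bar R :=
  ereal_sup [set n%:R%:E | n in [set n : nat |
    exists F : 'I_n -> plmap R,
      (forall i, zigzag_cover (F i) g d lam mu P) /\
      (forall i j, i != j -> ~ cover_iso (F i) (F j))]]%classic.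

(* Main.v *)
Require Import Defs.
From mathcomp Require Import all_boot all_order all_algebra.
From mathcomp Require Import all_classical all_reals all_analysis.
From mathcomp Require Import zify.

Set Implicit Arguments.
Unset Strict Implicit.
Unset Printing Implicit Defensive.

Import Order.TTheory GRing.Theory Num.Theory.
Import numFieldNormedType.Exports.

Local Open Scope ring_scope.

(* Each even part [2k] becomes a tail that is a single leaf, and each pair
   [(k, k)] of odd parts a tail that ends in a fork.  A string can carry all
   these tails in any order: its flow changes by an even amount at each tail, so
   it stays odd, hence nonzero, and orients the string.  All symmetric cycles are
   put on one tail with a fork.
   - If [lam0] and [mu0] have two parts together, the string is a path between
     two ends of these weights.
   - If they are empty and [g = 0], the string is a path both of whose ends come
     from one pair [(k, k)]; the excluded types are those where it would carry a
     single tail, and so form a symmetric fork.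
   - If they are empty and [g > 0], the string is a loop.  With the tails on the
     left attached before those on the right, and flow [-1] on the closing edge,
     all other edges of the loop have positive flow, so no directed cycle arises.
   In each case the vertices have integer heights that increase along the flow;
   sorting the vertices by height places them over the given points. *)

(** * Covers from positions of vertices *)

(** Two constraints shape the construction: no edge of the string may lie in a symmetric cycle or in
    an odd symmetric fork, and the orientation by the flow must be acyclic. A fork can only arise on
    a path with a single tail, a symmetric cycle only on a loop with two vertices. Since [d] has the
    parity of [size lam0] and of [size mu0], these sizes add up to 0 or 2. If the sum is 2, the two
    ends of the path differ in side or in weight, because neither [lam0] nor [mu0] has a repeated
    part. If it is 0, excluding the given types leaves at least three tails: enough for a loop
    without parallel edges, and for a path that still has two tails after one pair has been spent on
    its ends. The flow on a loop is determined by the tails only up to a constant. Its partial sums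
    are even, so the constant must be odd; with -1 the closing edge alone is negative, while a
    positive constant would make the whole loop a directed cycle. *)

(* The vertices of a layout sit at prescribed points of the extended line; its
   edges run from left to right and are mapped affinely. *)
Record layout (R : realType) := Layout {
  lgraph :> multigraph;
  lweight : edge lgraph -> nat;
  lpos : vert lgraph -> \bar R;
  l_connected : graph_connected lgraph;
  l_no_two_valent : forall v : vert lgraph, valence v != 2;
  lweight_gt0 : forall e, (0 < lweight e)%N;
  lpos_fin_num : forall v, (lpos v \is a fin_num) = is_inner v;
  lpos_lt : forall e, (lpos (endpt e false) < lpos (endpt e true))%E
}.

Section Layouts.
Variables (R : realType) (L : layout R).
Implicit Types (v : vert L) (e : edge L).

Definition llen e : R :=
  (fine (lpos (endpt e true)) - fine (lpos (endpt e false))) / (lweight e)%:R.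

Lemma lweightr_gt0 e : 0 < (lweight e)%:R :> R.
Proof. by rewrite ltr0n lweight_gt0. Qed.

Lemma llen_gt0 e : ~~ is_leaf e -> 0 < llen e.
Proof.
rewrite negb_or => /andP[i0 i1].
rewrite divr_gt0 ?lweightr_gt0 // subr_gt0.
by apply: fine_lt; rewrite ?lpos_fin_num ?lpos_lt.
Qed.

Definition lcurve := TropicalCurve (@l_connected _ L)
  (@l_no_two_valent _ L) llen_gt0.

Definition lemap e (t : R) : R :=
  fine (lpos (endpt e false)) + (lweight e)%:R * t.

Lemma lemap_coord e b :
  lemap e (@edge_coord _ lcurve e b) = fine (lpos (endpt e b)).
Proof.
rewrite /lemap; case: b => /=; rewrite ?mulr0 ?addr0 //.
by rewrite /llen mulrC divfK ?subrKC // gt_eqF // lweightr_gt0.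
Qed.

Lemma lpos_end_false e : is_end (endpt e false) -> lpos (endpt e false) = -oo%E.
Proof.
move=> h; have := lpos_lt e; have := lpos_fin_num (endpt e false).
by rewrite /is_inner h; case: (lpos (endpt e false)) => // _; rewrite ltNge leey.
Qed.

Lemma lpos_end_true e : is_end (endpt e true) -> lpos (endpt e true) = +oo%E.
Proof.
move=> h; have := lpos_lt e; have := lpos_fin_num (endpt e true).
by rewrite /is_inner h; case: (lpos (endpt e true)) => // _; rewrite ltNge leNye.
Qed.

Lemma lemap_inner e b : is_inner (endpt e b) ->
  (lemap e (@edge_coord _ lcurve e b))%:E = lpos (endpt e b).
Proof. by move=> h; rewrite lemap_coord fineK // lpos_fin_num. Qed.

Lemma lemap_end_false e : is_end (endpt e false) ->
  ((lemap e t)%:E @[t --> -oo] --> lpos (endpt e false))%classic.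
Proof.
move=> /lpos_end_false ->; apply/cvgerNyP; apply: cvg_comp; last exact: cvg_addrl_Ny.
by apply: gt0_cvgMrNy; rewrite ?lweightr_gt0.
Qed.

Lemma lemap_end_true e : is_end (endpt e true) ->
  ((lemap e t)%:E @[t --> +oo] --> lpos (endpt e true))%classic.
Proof.
move=> /lpos_end_true ->; apply/cvgeryP; apply: cvg_comp; last exact: cvg_addrl.
by apply: gt0_cvgMry; rewrite ?lweightr_gt0.
Qed.

Lemma lemap_dist e (s t : R) : @edge_dom _ lcurve e s -> @edge_dom _ lcurve e t ->
  `|lemap e s - lemap e t| = (lweight e)%:R * `|s - t|.
Proof.
by move=> _ _; rewrite /lemap opprD addrACA subrr add0r -mulrBr normrM ger0_norm.
Qed.

Definition lmap : plmap R := @PLMap R lcurve (@lpos _ L) lemap (@lweight _ L)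
  (@lpos_fin_num _ L) lemap_inner lemap_end_false lemap_end_true lemap_dist.

(** [lpos] is infinite at an end, so the inequality there is void, just as the condition of
    [edge_dom] is; at an inner endpoint both express the same bound, since [lemap] is increasing. *)
Lemma lmap_edge_image e y : edge_image (e : edge lmap) y <->
  (lpos (endpt e false) <= y%:E <= lpos (endpt e true))%E.
Proof.
have w0 := lweightr_gt0 e.
have leftE t : (is_inner (endpt e false) -> 0 <= t) <->
    (lpos (endpt e false) <= (lemap e t)%:E)%E.
  have [i|ni] := boolP (is_inner (endpt e false)).
    rewrite -(fineK (_ : lpos _ \is a fin_num)) ?lpos_fin_num // lee_fin.
    rewrite /lemap lerDl pmulr_rge0 //; split; first exact.
    by move=> h _.
  rewrite lpos_end_false ?leNye; last by rewrite negbK in ni.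
  by split.
have rightE t : (is_inner (endpt e true) -> t <= llen e) <->
    ((lemap e t)%:E <= lpos (endpt e true))%E.
  have [i|ni] := boolP (is_inner (endpt e true)).
    rewrite -(fineK (_ : lpos _ \is a fin_num)) ?lpos_fin_num // lee_fin.
    rewrite /lemap -lerBrDl /llen ler_pdivlMr // mulrC; split; first exact.
    by move=> h _.
  rewrite lpos_end_true ?leey; last by rewrite negbK in ni.
  by split.
split.
  move=> [t [/leftE h0 /rightE h1] <-].
  by apply/andP.
move=> /andP[h0 h1].
have yE : lemap e ((y - fine (lpos (endpt e false))) / (lweight e)%:R) = y.
  by rewrite /lemap mulrC divfK ?subrKC ?gt_eqF.
exists ((y - fine (lpos (endpt e false))) / (lweight e)%:R) => //.
by split; [apply/leftE; rewrite yE|apply/rightE; rewrite yE].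
Qed.

Lemma lmap_edge_image_eq e e' :
  (forall b, lpos (endpt e b) = lpos (endpt e' b)) ->
  edge_image (e : edge lmap) = edge_image (e' : edge lmap).
Proof.
move=> h; apply/funext => y; apply/propext.
by rewrite !lmap_edge_image !h.
Qed.

Lemma lmap_rises e b : is_inner (endpt e b) -> rises (e : edge lmap) b = ~~ b.
Proof.
move=> i; have w0 := lweightr_gt0 e.
case: b i => i /=; last first.
  apply/asboolP => t [/(_ i) t0 _] tn0.
  by rewrite /lemap ltrD2l ltr_pM2l // lt_def tn0.
apply/asboolP => H.
have [i0|i0] := boolP (is_inner (endpt e false)).
  have l0 : 0 < llen e by apply: llen_gt0; rewrite negb_or; apply/andP.
  have := H 0; rewrite /lemap /= ltrD2l ltr_pM2l // ltNge ltW //.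
  move/(_ _)/implyP; rewrite implybF lt_eqF // => /(_ _)/negP; apply => //.
  by split=> // _; exact: ltW.
(* With an end on the left the domain is unbounded below, so any point left of [llen e] refutes
   [H]. *)
have := H (llen e - 1); rewrite /lemap /= ltrD2l ltr_pM2l //.
rewrite ltNge gerBl ler01 /= => h; suff : false by []; apply: h.
  by split=> [|_]; rewrite ?(negPf i0) // gerBl.
by rewrite lt_eqF // gtrBl ltr01.
Qed.

Lemma lmap_falls e b : is_inner (endpt e b) -> falls (e : edge lmap) b = b.
Proof.
move=> i; have w0 := lweightr_gt0 e.
case: b i => i /=.
  apply/asboolP => t [_ /(_ i) t0] tn0.
  by rewrite /lemap ltrD2l ltr_pM2l // lt_def eq_sym tn0.
apply/asboolP => H.
have [i0|i0] := boolP (is_inner (endpt e true)).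
  have l0 : 0 < llen e by apply: llen_gt0; rewrite negb_or; apply/andP.
  have := H (llen e); rewrite /lemap /= ltrD2l ltr_pM2l // ltNge ltW //.
  move=> h; suff : false by []; apply: h; last by rewrite gt_eqF.
  by split=> // _; exact: ltW.
have := H 1; rewrite /lemap /= ltrD2l ltr_pM2l //.
rewrite ltNge ler01 /= => h; suff : false by []; apply: h.
  by split=> [_|]; rewrite ?(negPf i0) // ler01.
by rewrite oner_eq0.
Qed.

Lemma lmap_morphism :
  (forall v, is_inner v ->
    \sum_(e : edge L | endpt e true == v) lweight e =
    \sum_(e : edge L | endpt e false == v) lweight e)%N ->
  tropical_morphism lmap.
Proof.
move=> bal v iv.
have Hb (b : bool) : (\sum_(e : edge L | endpt e b == v) lweight e)%N =
   (\sum_(h : edge lmap * bool | (endpt h.1 h.2 == v) && (h.2 == b)) lweight h.1)%N.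
  transitivity (\sum_(e : edge L) \sum_(c : bool | (endpt e c == v) && (c == b))
      lweight e)%N; last first.
    by rewrite pair_big_dep /=; apply: eq_bigl => -[e c] /=.
  rewrite [LHS]big_mkcond; apply: eq_bigr => e _.
  rewrite big_mkcond big_bool /=.
  by case: b; rewrite ?andbT ?andbF ?addn0 ?add0n.
rewrite (eq_bigl (fun h : edge lmap * bool => (endpt h.1 h.2 == v) && (h.2 == false))).
  rewrite [RHS](eq_bigl (fun h : edge lmap * bool =>
    (endpt h.1 h.2 == v) && (h.2 == true))).
    by rewrite -!Hb bal.
  move=> [e b] /=; have [ev|//] := eqVneq (endpt e b) v.
  by rewrite lmap_falls ?ev //; case: b {ev}.
move=> [e b] /=; have [ev|//] := eqVneq (endpt e b) v.
by rewrite lmap_rises ?ev //; case: b {ev}.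
Qed.

Lemma lmap_leaf_weights (z : \bar R) :
  @leaf_weights _ lmap z = [seq lweight e | e <- enum (edge L) &
     [exists b, is_end (endpt e b) && (lpos (endpt e b) == z)]].
Proof. by []. Qed.

Lemma sumn_leaf_weightsNy :
  sumn (@leaf_weights _ lmap -oo%E) =
  (\sum_(e : edge L | is_end (endpt e false)) lweight e)%N.
Proof.
rewrite lmap_leaf_weights sumnE big_map big_filter big_enum_cond /=.
apply: eq_bigl => e; apply/existsP/idP => [[[] /andP[h0 /eqP h1]]|h] //.
  by move: h1; rewrite lpos_end_true.
by exists false; rewrite h lpos_end_false.
Qed.

(** Cut the line at [y]: an edge passes over [y] iff its left endpoint lies left of [y] and its
    right endpoint does not. Summed over all vertices left of [y], outgoing minus incoming weight
    cancels at the inner vertices by balancing, and what remains is the total weight [d] of the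
    leaves coming from minus infinity. *)
Lemma lmap_degree d :
  (forall v, is_inner v ->
    \sum_(e : edge L | endpt e true == v) lweight e =
    \sum_(e : edge L | endpt e false == v) lweight e)%N ->
  sumn (@leaf_weights _ lmap -oo%E) = d ->
  has_degree lmap d.
Proof.
move=> bal dE y yP.
pose lft v := (lpos v < y%:E)%E.
have sumE b : (\sum_(v | lft v) \sum_(e : edge L | endpt e b == v) lweight e
   = \sum_(e : edge L | lft (endpt e b)) lweight e)%N.
  rewrite (exchange_big_dep xpredT) //= [RHS]big_mkcond.
  apply: eq_bigr => e _.
  have [le|nle] := boolP (lft (endpt e b)).
    rewrite (big_pred1 (endpt e b)) // => v /=.
    by rewrite [endpt e b == v]eq_sym; case: eqP => [->|]; rewrite ?le ?andbF.
  rewrite big_pred0 // => v; apply/andP => -[lv /eqP ev].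
  by rewrite ev lv in nle.
have cutE : (\sum_(e : edge L | lft (endpt e false)) lweight e =
   d + \sum_(e : edge L | lft (endpt e true)) lweight e)%N.
  rewrite -!sumE.
  rewrite (bigID (fun v => is_end v)) /= [X in (_ = _ + X)%N](bigID (fun v => is_end v)) /=.
  rewrite [X in (_ + X)%N](eq_bigr (fun v =>
    \sum_(e : edge L | endpt e true == v) lweight e)%N); last first.
    by move=> v /andP[_ iv]; rewrite bal.
  rewrite addnA; congr (_ + _)%N.
  rewrite [X in (_ = _ + X)%N]big1 ?addn0; last first.
    move=> v /andP[lv ev]; apply: big_pred0 => e; apply/eqP => evE.
    by move: lv; rewrite /lft -evE lpos_end_true // evE.
  rewrite -dE sumn_leaf_weightsNy (exchange_big_dep xpredT) //= [RHS]big_mkcond.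
  apply: eq_bigr => e _.
  have [ee|nee] := boolP (is_end (endpt e false)).
    rewrite (big_pred1 (endpt e false)) // => v /=.
    rewrite [endpt e false == v]eq_sym; case: eqP => [->|]; rewrite ?andbF //.
    by rewrite ee /lft lpos_end_false // ltNyr.
  rewrite big_pred0 // => v; apply/andP => -[/andP[_ ev] /eqP evE].
  by rewrite evE ev in nee.
have /= neqy v : lpos v != y%:E := yP v.
have : (\sum_(e : edge L | lft (endpt e false)) lweight e =
  \sum_(e : edge L | `[< edge_image (e : edge lmap) y >]) lweight e +
  \sum_(e : edge L | lft (endpt e true)) lweight e)%N.
  rewrite [LHS]big_mkcond /= [X in (_ = X + _)%N]big_mkcond.
  rewrite [X in (_ = _ + X)%N]big_mkcond -big_split /=; apply: eq_bigr => e _.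
  have -> : `[< edge_image (e : edge lmap) y >] = lft (endpt e false) && ~~ lft (endpt e true).
    apply/asboolP/idP => [/lmap_edge_image/andP[h0 h1]|/andP[h0 h1]].
      by rewrite /lft lt_neqAle neqy h0 -leNgt h1.
    by apply/lmap_edge_image; rewrite ltW //= leNgt.
  have : lft (endpt e true) -> lft (endpt e false).
    by move=> h; apply: lt_trans h; exact: lpos_lt.
  by case: (lft (endpt e true)); case: (lft (endpt e false)) => //= h;
    rewrite ?addn0 ?add0n //; have := h isT.
by rewrite cutE => /addIn.
Qed.

Lemma lmap_cover g d lam mu (P : seq R) :
  (forall v, is_inner v ->
    \sum_(e : edge L | endpt e true == v) lweight e =
    \sum_(e : edge L | endpt e false == v) lweight e)%N ->
  (#|edge L| + 1 = g + #|vert L|)%N ->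
  sumn lam = d ->
  perm_eq (@leaf_weights _ lmap -oo%E) lam ->
  perm_eq (@leaf_weights _ lmap +oo%E) mu ->
  (forall p, p \in P -> exists2 v : vert L, is_inner v & lpos v = p%:E) ->
  tropical_cover lmap g d lam mu P.
Proof.
move=> bal gE lamE lamP muP PP; split=> //.
- exact: lmap_morphism.
- by apply: lmap_degree => //; rewrite (perm_sumn lamP).
- have := betti1E (@l_connected _ L); rewrite gE => /eqP.
  by rewrite eqn_add2r => /eqP.
Qed.

End Layouts.

(** Only the order of the inner vertices along the line matters. Sorting by height breaks ties
    arbitrarily, which is harmless because the heights at the two endpoints of an inner edge differ
    strictly. The increasing list of the points of [P] then gives the positions. *)
Lemma positions_of_heights (R : realType) (G : multigraph) (h : vert G -> int)
    (side : vert G -> bool) (P : seq R) :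
  (forall e : edge G, is_inner (endpt e false) -> is_inner (endpt e true) ->
     h (endpt e false) < h (endpt e true)) ->
  (forall (e : edge G) b, is_end (endpt e b) -> side (endpt e b) = b) ->
  uniq P -> size P = #|[set v : vert G | is_inner v]| ->
  exists x : vert G -> \bar R,
  [/\ forall v, (x v \is a fin_num) = is_inner v,
      forall v, is_end v -> x v = if side v then +oo%E else -oo%E,
      forall e, (x (endpt e false) < x (endpt e true))%E
    & forall p, p \in P -> exists2 v, is_inner v & x v = p%:E].
Proof.
move=> h_lt sideE uP sP.
pose leh := relpre h (<=%O : rel int).
have leh_tr : transitive leh by move=> a b c; exact: le_trans.
have leh_refl : reflexive leh by move=> a; exact: lexx.
have leh_tot : total leh by move=> a b; exact: le_total.
pose vs := sort leh (enum [set v : vert G | is_inner v]).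
pose ps := sort <=%O P.
have svs : size vs = size ps by rewrite !size_sort -cardE sP.
have mvs v : (v \in vs) = is_inner v by rewrite mem_sort mem_enum inE.
have uvs : uniq vs by rewrite sort_uniq enum_uniq.
have ps_lt : sorted <%O ps by rewrite sort_lt_sorted.
pose x v : \bar R := if is_inner v then (nth 0 ps (index v vs))%:E
  else if side v then +oo%E else -oo%E.
exists x; split.
- by move=> v; rewrite /x; case: (is_inner v) => //; case: (side v).
- by move=> v ev; rewrite /x /is_inner ev.
- move=> e; rewrite /x.
  have [i0|] := boolP (is_inner (endpt e false)); last first.
    rewrite negbK => /sideE ->.
    have [//|] := boolP (is_inner (endpt e true)); first by rewrite ltNyr.
    by rewrite negbK => /sideE ->.
  have [i1|] := boolP (is_inner (endpt e true)); last first.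
    by rewrite negbK => /sideE ->; rewrite ltry.
  rewrite lte_fin lt_sorted_ltn_nth ?inE -?svs ?index_mem ?mvs //.
  rewrite ltnNge; apply/negP => le.
  have := sorted_leq_index leh_tr leh_refl (sort_sorted leh_tot _).
  move=> /(_ (enum [set v : vert G | is_inner v])).
  move=> /(_ (endpt e true) (endpt e false)).
  rewrite -/vs !mvs => /(_ i1 i0 le).
  by rewrite /leh /= leNgt h_lt.
- move=> p pP.
  have : (index p ps < size vs)%N by rewrite svs index_mem mem_sort.
  case: vs mvs uvs svs @x => // v0 vs mvs uvs svs x lt.
  exists (nth v0 (v0 :: vs) (index p ps)); first by rewrite -mvs mem_nth.
  rewrite /x -mvs mem_nth // index_uniq // nth_index //.
  by rewrite mem_sort.
Qed.

(** * Tails *)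

Lemma big_unit (S : Type) (idx : S) (op : Monoid.law idx) (F : unit -> S) :
  \big[op/idx]_(i : unit) F i = F tt.
Proof. by rewrite (big_pred1 tt) // => -[]. Qed.

Lemma sum_eq1 (T : finType) (x : T) : (\sum_y (y == x))%N = 1%N.
Proof. by rewrite (bigD1 x) //= eqxx big1 // => y /negPf ->. Qed.

Lemma valenceE (G : multigraph) (v : vert G) :
  valence v = (\sum_(e : edge G) ((endpt e false == v) + (endpt e true == v)))%N.
Proof.
transitivity (\sum_(e : edge G) \sum_(b : bool) (endpt e b == v))%N.
  rewrite pair_bigA /= /valence -sum1_card big_mkcond /=.
  by apply: eq_bigr => h _; rewrite inE; case: eqP.
by apply: eq_bigr => e _; rewrite big_bool addnC.
Qed.

Section RootedValence.
Variables (V E : finType) (ep : E -> bool -> option V).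

(** The root [None] gets no valence of its own: it depends on the vertex to which the root is glued.
    Skeletons use the same count through [Some]. *)
Definition rooted_valence (v : V) : nat :=
  (\sum_e ((ep e false == Some v) + (ep e true == Some v)))%N.

End RootedValence.

(* The root vertex is [None]; edges point away from it, from [tep e false] to
   [tep e true].  The edge at the root has weight [2k], and [tparts] lists the
   weights of the leaves. *)
Record tail (k : nat) := Tail {
  tv : finType;
  te : finType;
  tep : te -> bool -> option tv;
  tw : te -> nat;
  th : option tv -> nat;
  troot : te;
  tcyc : nat;
  tparts : seq nat;
  tep_root : forall e b, (tep e b == None) = (e == troot) && ~~ b;
  tval13 : forall v, rooted_valence tep v \in [:: 1; 3]%N;
  tw_gt0 : (0 < k)%N -> forall e, (0 < tw e)%N;
  tw_root : tw troot = k.*2;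
  th_root : th None = 0%N;
  th_lt : forall e, (th (tep e false) < th (tep e true))%N;
  tep_start : forall e v, tep e false = Some v -> rooted_valence tep v != 1%N;
  t_balanced : forall v, rooted_valence tep v != 1%N ->
    (\sum_e (tep e true == Some v) * tw e =
     \sum_e (tep e false == Some v) * tw e)%N;
  t_card : #|te| = (#|tv| + tcyc)%N;
  t_inner : (\sum_v (rooted_valence tep v != 1%N) + 1 = tcyc.*2 + size tparts)%N;
  t_leaves : forall m,
    (\sum_e \sum_v [&& tep e true == Some v, rooted_valence tep v == 1%N & tw e == m]
     = count_mem m tparts)%N;
  t_connected : forall (Pv : pred tv) (Pe : pred te), Pe troot ->
    (forall e b v, tep e b = Some v -> Pv v = Pe e) ->
    (forall v, Pv v) /\ (forall e, Pe e)
}.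

Lemma eq_inl (A B : eqType) (x y : A) : ((inl x : A + B) == inl y) = (x == y).
Proof. by []. Qed.
Lemma eq_inr (A B : eqType) (x y : B) : ((inr x : A + B) == inr y) = (x == y).
Proof. by []. Qed.
Lemma eq_inlr (A B : eqType) (x : A) (y : B) : ((inl x : A + B) == inr y) = false.
Proof. by []. Qed.
Lemma eq_inrl (A B : eqType) (x : A) (y : B) : ((inr y : A + B) == inl x) = false.
Proof. by []. Qed.
Lemma eq_Some (A : eqType) (x y : A) : (Some x == Some y) = (x == y).
Proof. by []. Qed.
Lemma eq_NoneSome (A : eqType) (y : A) : (None == Some y) = false.
Proof. by []. Qed.
Definition eq_sumE := (eq_inl, eq_inr, eq_inlr, eq_inrl, eq_Some, eq_NoneSome).

Definition sum_unfold := (big_sumType, big_bool, big_unit, eq_sumE).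

Section LeafTail.
Variable k : nat.

Definition leaf_ep (e : unit) (b : bool) : option unit := if b then Some tt else None.

Lemma leaf_val v : rooted_valence leaf_ep v = 1%N.
Proof. by case: v; rewrite /rooted_valence big_unit. Qed.

Definition leaf_tail : tail k.
Proof.
refine (@Tail k unit unit leaf_ep (fun=> k.*2) (fun o => isSome o) tt 0 [:: k.*2]
  _ _ _ _ _ _ _ _ _ _ _ _).
- by move=> [] [].
- by move=> v; rewrite leaf_val.
- by move=> k0 _; rewrite double_gt0.
- by [].
- by [].
- by [].
- by move=> [] v.
- by move=> v; rewrite leaf_val.
- by rewrite card_unit.
- by rewrite big_unit leaf_val.
- by move=> m; rewrite !big_unit leaf_val /= addn0.
- by move=> Pv Pe Pr H; split; case=> //; rewrite (H tt true).
Defined.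

End LeafTail.

Section ForkTail.
Variable k : nat.

Definition fork_ep (e : unit + bool) (b : bool) : option (unit + bool) :=
  match e with
  | inl _ => if b then Some (inl tt) else None
  | inr c => if b then Some (inr c) else Some (inl tt)
  end.

Lemma fork_val v : rooted_valence fork_ep v = if v is inl _ then 3%N else 1%N.
Proof. by case: v => [[]|[]]; rewrite /rooted_valence !sum_unfold. Qed.

Definition fork_tail : tail k.
Proof.
refine (@Tail k (unit + bool)%type (unit + bool)%type fork_ep
  (fun e => if e is inl _ then k.*2 else k)
  (fun o => match o with None => 0 | Some (inl _) => 1 | Some (inr _) => 2 end)%N
  (inl tt) 0 [:: k; k] _ _ _ _ _ _ _ _ _ _ _ _).
- by move=> [[]|[]] [].
- by move=> v; rewrite fork_val; case: v.
- by move=> k0 [_|_] //; rewrite double_gt0.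
- by [].
- by [].
- by move=> [[]|[]].
- by move=> [[]|[]] //= v [<-]; rewrite fork_val.
- move=> v; rewrite fork_val; case: v => [[]|] // _.
  by rewrite !sum_unfold /= !mul1n !mul0n; lia.
- by rewrite card_sum card_unit card_bool.
- by rewrite !sum_unfold !fork_val.
- by move=> m; rewrite !sum_unfold !fork_val /=; lia.
- move=> Pv Pe Pr H.
  have P0 : Pv (inl tt) by rewrite (H (inl tt) true).
  have P1 c : Pe (inr c) by rewrite -(H (inr c) false (inl tt)).
  split; first by case=> [[]|c] //; rewrite (H (inr c) true).
  by case=> [[]|c].
Defined.

End ForkTail.

Section CycleTail.
Variables (k : nat) (T : tail k).

Definition cycle_vert (o : option (tv T)) : bool + tv T :=
  if o is Some v then inr v else inl true.

(** A stem of weight [2k] ends at [inl false], two edges of weight [k] lead on to [inl true], and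
    there [T], again of root weight [2k], is attached. The weight along the chain is preserved, so a
    cycle raises the genus by one without changing the leaves. *)
Definition cycle_ep (e : (unit + bool) + te T) (b : bool) : option (bool + tv T) :=
  match e with
  | inl (inl _) => if b then Some (inl false) else None
  | inl (inr _) => Some (inl b)
  | inr e => Some (cycle_vert (tep e b))
  end.

Lemma cycle_vert_inr o v : (cycle_vert o == inr v) = (o == Some v).
Proof. by case: o. Qed.

Lemma cycle_vert_true o : (cycle_vert o == inl true) = (o == None).
Proof. by case: o. Qed.

Lemma cycle_vert_false o : (cycle_vert o == inl false) = false.
Proof. by case: o. Qed.

Definition cycle_vertE := (cycle_vert_inr, cycle_vert_true, cycle_vert_false).

Lemma cycle_val v : rooted_valence cycle_ep v =
  if v is inr v then rooted_valence (@tep _ T) v else 3%N.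
Proof.
rewrite /rooted_valence !sum_unfold /=.
case: v => [[]|v]; rewrite !eq_sumE /=.
- under eq_bigr => e _ do rewrite !eq_sumE !cycle_vertE !tep_root andbT andbF addn0.
  by rewrite sum_eq1.
- by rewrite big1 // => e _; rewrite !eq_sumE !cycle_vertE.
- by rewrite !add0n; apply: eq_bigr => e _; rewrite !eq_sumE !cycle_vertE.
Qed.

Definition cycle_tail : tail k.
Proof.
refine (@Tail k (bool + tv T)%type ((unit + bool) + te T)%type cycle_ep
  (fun e => match e with inl (inl _) => k.*2 | inl _ => k | inr e => tw e end)
  (fun o => match o with None => 0 | Some (inl b) => b.+1
            | Some (inr v) => (th (Some v)).+2 end)%N
  (inl (inl tt)) (tcyc T).+1 (tparts T) _ _ _ _ _ _ _ _ _ _ _ _).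
- by move=> [[[]|[]]|e] [].
- by move=> v; rewrite cycle_val; case: v => // v; exact: tval13.
- by move=> k0 [[_|_]|e] //; rewrite ?double_gt0 ?tw_gt0.
- by [].
- by [].
- move=> [[[]|[]]|e] //=.
  have := th_lt e; have := tep_root e true.
  case: (tep e true) => [v|] //=; last by rewrite andbF.
  move=> _; case: (tep e false) => //.
  by move: (th_root T) => ->.
- move=> [[[]|[]]|e] //= v [<-]; rewrite cycle_val //.
  by case E: (tep e false) => [u|] //=; exact: (tep_start E).
- move=> v; rewrite cycle_val; case: v => [[]|v].
  + move=> _; rewrite !sum_unfold /= ?eq_sumE /=.
    (* At [inl true] the only outgoing edge is the root edge of [T], of weight [2k]; it balances the
       two incoming edges of weight [k]. *)
    rewrite [X in (_ = _ + X)%N](bigD1 (troot T)) //= eq_sumE cycle_vertE.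
    rewrite tep_root eqxx /= tw_root mul1n.
    rewrite big1 ?[X in (_ = _ + (_ + X))%N]big1 //; last 2 first.
    * by move=> e /negPf ne; rewrite eq_sumE cycle_vertE tep_root ne.
    * by move=> e _; rewrite eq_sumE cycle_vertE tep_root andbF.
    by lia.
  + move=> _; rewrite !sum_unfold /= ?eq_sumE /=.
    rewrite big1 ?[X in (_ = _ + X)%N]big1 //; last 2 first.
    * by move=> e _; rewrite eq_sumE cycle_vertE.
    * by move=> e _; rewrite eq_sumE cycle_vertE.
    by lia.
  + move=> /t_balanced bal; rewrite !sum_unfold /= ?eq_sumE /= !mul0n !add0n.
    under eq_bigr => e _ do rewrite eq_sumE cycle_vertE.
    by rewrite bal; apply: eq_bigr => e _; rewrite eq_sumE cycle_vertE.
- by rewrite !card_sum card_unit !card_bool t_card; lia.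
- rewrite !sum_unfold !cycle_val /=.
  under eq_bigr => v _ do rewrite cycle_val.
  by have := t_inner T; lia.
- move=> m; rewrite big_sumType /= -[RHS]t_leaves -[RHS]add0n; congr (_ + _)%N.
    apply: big1 => e _; apply: big1 => v _; rewrite cycle_val.
    by case: e => [[]|[]]; case: v => [[]|v].
  apply: eq_bigr => e _; rewrite !sum_unfold !cycle_val /= !andbF !add0n.
  by apply: eq_bigr => v _; rewrite !eq_sumE cycle_vertE cycle_val.
- move=> Pv Pe Pr H.
  have P0 : Pv (inl false) by rewrite (H (inl (inl tt)) true).
  have P1 c : Pe (inl (inr c)) by rewrite -(H (inl (inr c)) false (inl false)).
  have P2 : Pv (inl true) by rewrite (H (inl (inr true)) true).
  have [||Pv' Pe'] := @t_connected _ T (fun v => Pv (inr v)) (fun e => Pe (inr e)).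
  + rewrite -(H (inr (troot T)) false (inl true)) //=.
    by have := tep_root (troot T) false; rewrite eqxx /=; case: (tep _ _).
  + by move=> e b v ev; rewrite (H (inr e) b) //= ev.
  by split=> [[[]|v]|[[[]|b]|e]].
Defined.

End CycleTail.

(** * Abstract tails as subgraphs of a cover *)

Section TailSubgraph.
Variables (R : realType) (phi : plmap R) (k : nat) (T : tail k).
Variables (r : vert phi) (c : bool).
Variables (iv : tv T -> vert phi) (ie : te T -> edge phi).

(* [c] tells whether the orientations of the edges are reversed. *)
Record tail_embedding : Prop := TailEmbedding {
  emb_vert_inj : injective iv;
  emb_edge_inj : injective ie;
  emb_endpt : forall e b, endpt (ie e) (b (+) c) = oapp iv r (tep e b);
  emb_weight : forall e, weight (ie e) = tw e;
  emb_end : forall v, is_end (iv v) = (rooted_valence (@tep _ T) v == 1%N);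
  emb_vmap_end : forall u v, is_end (iv u) -> is_end (iv v) ->
    vmap (iv u) = vmap (iv v);
  emb_image : forall e e',
    (forall b, vmap (endpt (ie e) b) = vmap (endpt (ie e') b)) ->
    edge_image (ie e) = edge_image (ie e')
}.

Definition tail_cells : {set cell phi} :=
  [set x | match x with
           | inl v => v \in codom iv
           | inr e => e \in codom ie
           end].

Lemma emb_joins e : tail_embedding ->
  joins (ie e) (oapp iv r (tep e false)) (oapp iv r (tep e true)).
Proof.
move=> emb; apply/existsP; exists c.
by rewrite -(emb_endpt emb e false) -(emb_endpt emb e true) !eqxx.
Qed.

End TailSubgraph.

(** Quantifying over all embeddings makes this a property of the abstract tail. The induction over
    symmetric cycles needs it, because the shorter tail sits at a different root. *)
Definition is_chain k (T : tail k) : Prop :=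
  forall (R : realType) (phi : plmap R) r c iv ie,
  @tail_embedding R phi k T r c iv ie -> tail_chain r (tail_cells iv ie).

Definition is_even_leaf k (T : tail k) : Prop :=
  forall (R : realType) (phi : plmap R) r c iv ie,
  @tail_embedding R phi k T r c iv ie -> even_leaf r (tail_cells iv ie).

Lemma leaf_tail_is_even_leaf k : is_even_leaf (leaf_tail k).
Proof.
move=> R phi r c iv ie emb; exists (ie tt), (iv tt); split.
- exact: (emb_joins (tt : te (leaf_tail k)) emb).
- by rewrite (emb_end emb) leaf_val.
- by rewrite (emb_weight emb) /= odd_double.
apply/setP => -[v|e]; rewrite !inE ?orbF.
  by apply/codomP/eqP => [[[] ->]//|[->]]; exists tt.
by apply/codomP/eqP => [[[] ->]//|[->]]; exists tt.
Qed.

(** The symmetry of the fork is automatic: its two leaves share their inner vertex and their weight,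
    all ends of a tail have the same infinite value, and [emb_image] turns equal endpoint values
    into equal images. *)
Lemma fork_tail_is_chain k : odd k -> is_chain (fork_tail k).
Proof.
move=> ok R phi r c iv ie emb.
have e0 := emb_joins (inl tt : te (fork_tail k)) emb.
have e1 b := emb_joins (inr b : te (fork_tail k)) emb.
rewrite /= in e0 e1.
have bE b : endpt (ie (inr b)) (~~ c) = iv (inr b) by exact: (emb_endpt emb (inr b) true).
have wE b : endpt (ie (inr b)) c = iv (inl tt).
  exact: (emb_endpt emb (inr b) false).
have wI : is_inner (iv (inl tt)) by rewrite /is_inner (emb_end emb) fork_val.
have xI b : is_end (iv (inr b)) by rewrite (emb_end emb) fork_val.
have lf b : is_leaf (ie (inr b)).
  by rewrite /is_leaf; case: c bE {emb wE} => /= bE; rewrite bE xI ?orbT.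
have -> : tail_cells iv ie =
  [set ecell (ie (inl tt)); vcell (iv (inl tt)); ecell (ie (inr false));
    vcell (iv (inr false)); ecell (ie (inr true)); vcell (iv (inr true))].
  apply/setP => -[v|e]; rewrite !inE !eq_sumE ?orbF ?orFb.
    apply/codomP/idP => [[[[]|[]] ->]|]; rewrite ?eqxx ?orbT //.
    by case/orP => [/orP[]|] /eqP ->; eexists.
  apply/codomP/idP => [[[[]|[]] ->]|]; rewrite ?eqxx ?orbT //.
  by case/orP => [/orP[]|] /eqP ->; eexists.
apply: tail_chain_fork => //.
- by rewrite (emb_weight emb) /= odd_double.
- split.
  + by apply/eqP => /(emb_edge_inj emb).
  + by rewrite !lf.
  + exists (iv (inl tt)) => //.
    by apply/andP; split; apply/existsP; exists c; rewrite wE.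
  + by rewrite !(emb_weight emb).
  + apply: (emb_image emb) => b.
    have [->|->] : b = c \/ b = ~~ c by case: (b); case: (c); auto.
      by rewrite !wE.
    by rewrite !bE; apply: (emb_vmap_end emb).
- by rewrite (emb_weight emb).
Qed.

Lemma cycle_tail_is_chain k (T : tail k) : odd k -> is_chain T ->
  is_chain (cycle_tail T).
Proof.
move=> ok chT R phi r c iv ie emb.
have e0 := emb_joins (inl (inl tt) : te (cycle_tail T)) emb.
have e1 b := emb_joins (inl (inr b) : te (cycle_tail T)) emb.
rewrite /= in e0 e1.
have eE b b' : endpt (ie (inl (inr b))) (b' (+) c) = iv (inl b').
  exact: (emb_endpt emb (inl (inr b)) b').
have wI b : is_inner (iv (inl b)) by rewrite /is_inner (emb_end emb) cycle_val.
have nlf b : ~~ is_leaf (ie (inl (inr b))).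
  have H b' : is_inner (endpt (ie (inl (inr b))) b').
    by rewrite -[b'](addbK c) eE.
  by rewrite negb_or; apply/andP; split; exact: H.
(* The embedding restricts to [T], whose root is now the far vertex of the symmetric cycle. *)
have embT : tail_embedding (iv (inl true)) c (fun v : tv T => iv (inr v))
    (fun e : te T => ie (inr e)).
  split.
  - by move=> u v /(emb_vert_inj emb) [].
  - by move=> u v /(emb_edge_inj emb) [].
  - by move=> e b; rewrite (emb_endpt emb) /=; case: (tep e b).
  - by move=> e; rewrite (emb_weight emb).
  - by move=> v; rewrite (emb_end emb) cycle_val.
  - by move=> u v; exact: (emb_vmap_end emb).
  - by move=> e e'; exact: (emb_image emb).
have -> : tail_cells iv ie =
  [set ecell (ie (inl (inl tt))); vcell (iv (inl false));
     ecell (ie (inl (inr false))); ecell (ie (inl (inr true)));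
     vcell (iv (inl true))] :|:
  tail_cells (fun v : tv T => iv (inr v)) (fun e : te T => ie (inr e)).
  apply/setP => -[v|e]; rewrite !inE !eq_sumE ?orbF ?orFb.
    apply/codomP/idP => [[[[]|v'] ->]|]; rewrite ?eqxx ?orbT ?codom_f ?orbT //.
    by case/orP => [/orP[/eqP ->|/eqP ->]|/codomP[v' ->]]; eexists.
  apply/codomP/idP => [[[[[]|[]]|e'] ->]|]; rewrite ?eqxx ?orbT ?codom_f ?orbT //.
  by case/orP => [/orP[/orP[/eqP ->|/eqP ->]|/eqP ->]|/codomP[e' ->]]; eexists.
apply: tail_chain_cycle => //.
- by rewrite (emb_weight emb) /= odd_double.
- split.
  + by apply/eqP => /(emb_edge_inj emb).
  + by rewrite !nlf.
  + by exists (iv (inl false)), (iv (inl true)); rewrite !e1.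
  + by rewrite !(emb_weight emb).
  + by apply: (emb_image emb) => b; rewrite -[b](addbK c) !eE.
- by rewrite (emb_weight emb).
- exact: chT embT.
rewrite disjoint_subset; apply/fintype.subsetP => x; rewrite !inE.
do 4?[case/orP]; move=> /eqP -> /=; apply/codomP => -[y].
- by move=> /(emb_edge_inj emb).
- by move=> /(emb_vert_inj emb).
- by move=> /(emb_edge_inj emb).
- by move=> /(emb_edge_inj emb).
- by move=> /(emb_vert_inj emb).
Qed.

(** * Attaching tails to a string *)

(* A string with vertices in [I], ends in [X] and a signed flow on its edges:
   an edge with negative flow runs from [sep e true] to [sep e false] when it is
   read from left to right.  At each [i] a tail of weight [2 (k i)] is to be
   attached, on the right if [sg i] and on the left otherwise. *)
Record skeleton (I X : finType) (k : I -> nat) (sg : I -> bool) := Skeleton {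
  se : finType;
  sep : se -> bool -> I + X;
  flow : se -> int;
  sheight : I -> int;
  sside : X -> bool;
  flow_odd : forall e, odd `|flow e|;
  sval2 : forall i, rooted_valence (fun e b => Some (sep e b)) (inl i) = 2%N;
  sval1 : forall x, rooted_valence (fun e b => Some (sep e b)) (inr x) = 1%N;
  s_balanced : forall i,
    \sum_e (flow e *+ (sep e true == inl i) - flow e *+ (sep e false == inl i)) =
    (if sg i then (k i).*2%:Z else - (k i).*2%:Z);
  sheight_flow : forall e i j, sep e false = inl i -> sep e true = inl j ->
    0 < flow e * (sheight j - sheight i);
  sside_flow : forall e b x, sep e b = inr x -> sside x = b (+) (flow e < 0);
  s_connected : forall Q : pred (I + X),
    (forall e, Q (sep e false) = Q (sep e true)) -> forall u v, Q u -> Q v;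
  s_no_cycle : forall e e' i j b b', sep e b = inl i -> sep e (~~ b) = inl j ->
    sep e' b' = inl i -> sep e' (~~ b') = inl j -> e = e';
  s_no_fork : forall e e' i x x' b b', sep e b = inl i -> sep e (~~ b) = inr x ->
    sep e' b' = inl i -> sep e' (~~ b') = inr x' ->
    sside x = sside x' -> `|flow e|%N = `|flow e'|%N -> e = e'
}.

Lemma sum_sig (I : finType) (J : I -> finType) (S : nmodType)
    (F : {i : I & J i} -> S) :
  \sum_p F p = \sum_i \sum_(j : J i) F (Tagged J j).
Proof.
rewrite (sig_big_dep (fun=> true) (fun _ _ => true) (fun i j => F (Tagged J j))).
by apply: eq_bigr => -[].
Qed.

Section Glue.
Variables (I X : finType) (k : I -> nat) (sg : I -> bool).
Variables (K : skeleton X k sg) (T : forall i, tail (k i)).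
Hypothesis k_gt0 : forall i, (0 < k i)%N.

Definition gvert : finType := ((I + X) + {i : I & tv (T i)})%type.
Definition gedge : finType := (se K + {i : I & te (T i)})%type.

Definition tail_vert i (o : option (tv (T i))) : gvert :=
  if o is Some v then inr (Tagged (fun i => tv (T i)) v) else inl (inl i).

Definition gep0 (e : gedge) (b : bool) : gvert :=
  match e with
  | inl e => inl (sep e b)
  | inr p => tail_vert (tep (tagged p) b)
  end.

(** [gep0] orients the string as the skeleton does and the tails away from their roots. Reversing
    the edges of negative flow and the tails on the left makes every edge run from left to right. *)
Definition gflip (e : gedge) : bool :=
  match e with
  | inl e => flow e < 0
  | inr p => ~~ sg (tag p)
  end.

Definition glue_graph : multigraph :=
  @Multigraph gvert gedge (fun e b => gep0 e (b (+) gflip e)).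

Definition gweight (e : edge glue_graph) : nat :=
  match e with
  | inl e => `|flow e|%N
  | inr p => tw (tagged p)
  end.

(** A tail climbs from its string vertex if it is on the right and descends if it is on the left.
    The value at the ends of the string is a dummy, because only heights of inner vertices are ever
    compared. *)
Definition gheight (v : vert glue_graph) : int :=
  match v with
  | inl (inl i) => sheight K i
  | inl (inr _) => 0
  | inr p => sheight K (tag p) +
      (if sg (tag p) then (th (Some (tagged p)))%:Z
       else - (th (Some (tagged p)))%:Z)
  end.

Definition gside (v : vert glue_graph) : bool :=
  match v with
  | inl (inl _) => false
  | inl (inr x) => sside K x
  | inr p => sg (tag p)
  end.

Lemma gvert_inl (a b : I + X) : ((inl a : gvert) == inl b) = (a == b).
Proof. by []. Qed.

Lemma gvert_inr p q : ((inr p : gvert) == inr q) = (p == q).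
Proof. by []. Qed.

Lemma tail_vert_inr i (o : option (tv (T i))) v :
  (tail_vert o == inr (Tagged (fun i => tv (T i)) v)) = (o == Some v).
Proof. by case: o => [u|] //; rewrite /= gvert_inr eq_Tagged eq_Some. Qed.

Lemma tail_vert_neq i j (o : option (tv (T i))) (v : tv (T j)) : i != j ->
  (tail_vert o == inr (Tagged (fun i => tv (T i)) v)) = false.
Proof.
move=> ij; case: o => [u|] //; apply/eqP => -[e].
by case/eqP: ij; case: _ / e.
Qed.

Lemma tail_vert_inl i j (o : option (tv (T i))) :
  (tail_vert o == inl (inl j)) = (o == None) && (i == j).
Proof. by case: o. Qed.

Lemma tail_vert_end i x (o : option (tv (T i))) :
  (tail_vert o == inl (inr x)) = false.
Proof. by case: o. Qed.

(** Stated with [*+] over any [nmodType], so that this and the next two sums serve both the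
    valences, in [nat], and the flow, in [int]. *)
Lemma sum_gep0_tail (S : nmodType) i (v : tv (T i)) b (f : gedge -> S) :
  \sum_e f e *+ (gep0 e b == inr (Tagged (fun i => tv (T i)) v)) =
  \sum_(e : te (T i)) f (inr (Tagged (fun i => te (T i)) e)) *+ (tep e b == Some v).
Proof.
rewrite big_sumType /= big1 ?add0r; last by move=> e _; rewrite mulr0n.
rewrite sum_sig (bigD1 i) //= [X in _ + X]big1 ?addr0.
  by apply: eq_bigr => e _; rewrite tail_vert_inr.
by move=> j ji; apply: big1 => e _; rewrite /= tail_vert_neq // mulr0n.
Qed.

Lemma sum_gep0_inner (S : nmodType) i b (f : gedge -> S) :
  \sum_e f e *+ (gep0 e b == inl (inl i)) =
  \sum_e f (inl e) *+ (sep e b == inl i) +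
  f (inr (Tagged (fun i => te (T i)) (troot (T i)))) *+ (~~ b).
Proof.
rewrite big_sumType /=; congr (_ + _).
rewrite sum_sig (bigD1 i) //= [X in _ + X]big1 ?addr0.
  rewrite (bigD1 (troot (T i))) //= tail_vert_inl tep_root !eqxx /= andbT.
  rewrite big1 ?addr0 // => e /negPf ne.
  by rewrite tail_vert_inl tep_root ne mulr0n.
move=> j /negPf ji; apply: big1 => e _.
by rewrite /= tail_vert_inl ji andbF mulr0n.
Qed.

Lemma sum_gep0_end (S : nmodType) x b (f : gedge -> S) :
  \sum_e f e *+ (gep0 e b == inl (inr x)) =
  \sum_e f (inl e) *+ (sep e b == inr x).
Proof.
rewrite big_sumType /= [X in _ + X]big1 ?addr0.
  by apply: eq_bigr => e _; rewrite gvert_inl.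
by move=> e _; rewrite tail_vert_end mulr0n.
Qed.

Lemma sum_bool_nat (D : finType) (c : D -> bool) :
  (\sum_e c e)%N = \sum_e 1%N *+ c e.
Proof. by apply: eq_bigr => e _; rewrite natn. Qed.

(** A string vertex has two half-edges on the string and one on the root edge of its tail, hence
    valence 3. *)
Lemma gvalence (v : vert glue_graph) : valence v =
  match v with
  | inl (inl _) => 3
  | inl (inr _) => 1
  | inr p => rooted_valence (@tep _ (T (tag p))) (tagged p)
  end%N.
Proof.
rewrite valenceE /=.
transitivity (\sum_(e : gedge) (gep0 e false == v) +
              \sum_(e : gedge) (gep0 e true == v))%N.
  rewrite -big_split /=; apply: eq_bigr => e _.
  by case: (gflip e) => //=; rewrite addnC.
rewrite !sum_bool_nat; case: v => [[i|x]|[i v]].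
- rewrite !sum_gep0_inner -!sum_bool_nat.
  rewrite -[in RHS](sval2 K i) /rooted_valence big_split /=.
  by rewrite mulr0n addr0 -addSn mulr1n -[(_ + 1)%R]/(_ + 1)%N addn1.
- by rewrite !sum_gep0_end -!sum_bool_nat -(sval1 K x) /rooted_valence big_split.
- by rewrite !sum_gep0_tail -!sum_bool_nat /rooted_valence big_split.
Qed.

Lemma g_inner (v : vert glue_graph) : is_inner v =
  match v with
  | inl (inl _) => true
  | inl (inr _) => false
  | inr p => rooted_valence (@tep _ (T (tag p))) (tagged p) != 1%N
  end.
Proof. by rewrite /is_inner /is_end gvalence; case: v => [[]|]. Qed.

Lemma g_no_two_valent (v : vert glue_graph) : valence v != 2.
Proof.
rewrite gvalence; case: v => [[]|[i v]] //=.
by have := tval13 v; rewrite !inE => /orP[] /eqP ->.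
Qed.

Lemma gweight_gt0 e : (0 < gweight e)%N.
Proof.
case: e => [e|[i e]] /=; last exact: tw_gt0.
by have := flow_odd e; case: `|_|%N.
Qed.

(** The weight with the sign relative to the orientation of [gep0]. In this form the balance at a
    vertex is linear, and [s_balanced] and [t_balanced] apply without a case distinction on each
    edge. *)
Definition gflow (e : gedge) : int :=
  if gflip e then - (gweight e)%:Z else (gweight e)%:Z.

Lemma gflow_inl e : gflow (inl e) = flow e.
Proof. by rewrite /gflow /=; case: ltrP => h; lia. Qed.

Lemma gflow_balanced (v : vert glue_graph) : is_inner v ->
  \sum_e gflow e *+ (gep0 e true == v) = \sum_e gflow e *+ (gep0 e false == v).
Proof.
rewrite g_inner; case: v => [[i|x]|[i v]] //.
  move=> _; rewrite !sum_gep0_inner mulr0n addr0 mulr1n.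
  apply/eqP; rewrite -subr_eq0 opprD addrA -sumrB.
  have := s_balanced K i; under eq_bigr => e _ do rewrite -!gflow_inl.
  move=> ->; rewrite /gflow /= tw_root.
  by case: (sg i) => /=; rewrite ?subrr ?opprK ?addNr.
rewrite !sum_gep0_tail /= => /t_balanced bal.
have balZ : \sum_e ((tw e)%:Z *+ (tep e true == Some v)) =
            \sum_e ((tw e)%:Z *+ (tep e false == Some v)).
  have E b : \sum_e ((tw e)%:Z *+ (tep e b == Some v)) =
      (\sum_e (tep e b == Some v) * tw e)%N%:Z.
    rewrite (big_morph _ PoszD (erefl 0%:Z)); apply: eq_bigr => e _.
    by case: eqP => _; rewrite ?mul1n ?mul0n.
  by rewrite !E bal.
rewrite /gflow /=; case: (sg i) => //=.
under eq_bigr do rewrite mulNrn; under [RHS]eq_bigr do rewrite mulNrn.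
by rewrite !sumrN balZ.
Qed.

(** Reversing an edge exchanges its two endpoints and changes the sign of its flow, so the signed
    balance for [gep0] is the unsigned balance for the oriented graph. *)
Lemma g_balanced (v : vert glue_graph) : is_inner v ->
  (\sum_(e : edge glue_graph | endpt e true == v) gweight e =
   \sum_(e : edge glue_graph | endpt e false == v) gweight e)%N.
Proof.
move=> /gflow_balanced /eqP; rewrite -subr_eq0 -sumrB => /eqP bal.
apply/eqP; rewrite -eqz_nat !(big_morph _ PoszD (erefl 0%:Z)).
rewrite big_mkcond [X in _ == X]big_mkcond -subr_eq0 -sumrB -[X in _ == X]bal.
apply/eqP/eq_bigr => e _; rewrite /= /gflow; case: (gflip e) => /=.
  by case: eqP; case: eqP; rewrite ?mulr0n ?mulr1n ?subr0 ?sub0r ?opprK ?subrr ?addNr.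
by case: eqP; case: eqP.
Qed.

Lemma gside_end (e : edge glue_graph) b :
  is_end (endpt e b) -> gside (endpt e b) = b.
Proof.
rewrite -[is_end _]negbK -/(is_inner _) g_inner /=.
case: e => [e|[i e]] /=.
  case E: (sep _ _) => [//|x] _ /=.
  by rewrite (sside_flow E) addbK.
case E: (tep _ _) => [v|] //=; rewrite negbK => /eqP v1.
(* By [tep_start] no edge of a tail starts at an end, so the end is the endpoint far from the
   root. *)
have: b (+) ~~ sg i = true.
  by case: (b (+) _) E => // /tep_start; rewrite v1 eqxx.
by case: b {E}; case: (sg i).
Qed.

Lemma gheight_lt (e : edge glue_graph) :
  is_inner (endpt e false) -> is_inner (endpt e true) ->
  gheight (endpt e false) < gheight (endpt e true).
Proof.
rewrite !g_inner /=; case: e => [e|[i e]] /=.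
  case E0: (sep e false) => [i|x]; case E1: (sep e true) => [j|y];
    case: (ltrP (flow e) 0) => f /=; rewrite ?E0 ?E1 //= => _ _.
    have := sheight_flow E0 E1; nia.
  have := sheight_flow E0 E1; nia.
have h0 b : gheight (tail_vert (tep e b)) = sheight K i +
    (if sg i then (th (tep e b))%:Z else - (th (tep e b))%:Z).
  case: (tep e b) => //=; rewrite th_root.
  by case: (sg i); rewrite addr0.
move=> _ _; rewrite !h0; have := th_lt e.
by case: (sg i) => /=; lia.
Qed.

Lemma g_connected (i0 : I) : graph_connected glue_graph.
Proof.
split; first by apply/card_gt0P; exists (inl (inl i0)).
pose adj : rel (vert glue_graph) := fun x y => [exists e, joins e x y].
have adj_sym : connect_sym adj.
  apply: sym_connect_sym; apply: symmetric_from_pre => x y /existsP[e /existsP[b]].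
  rewrite andbC => h; apply/existsP; exists e.
  by apply/existsP; exists (~~ b); rewrite negbK.
move=> u; pose Q v := connect adj u v.
have Qe e : Q (gep0 e false) = Q (gep0 e true).
  rewrite /Q; apply: (same_connect_r adj_sym); apply: connect1.
  apply/existsP; exists (e : edge glue_graph); apply/existsP; exists (gflip e).
  by rewrite /= addbb addNb addbb !eqxx.
have Qs s t : Q (inl s) = Q (inl t).
  have H s' t' : Q (inl s') -> Q (inl t').
    by apply: (@s_connected _ _ _ _ K (fun s => Q (inl s))) => e; exact: (Qe (inl e)).
  by apply/idP/idP; exact: H.
have Qt i (v : tv (T i)) : Q (inr (Tagged (fun i => tv (T i)) v)) = Q (inl (inl i)).
  (* [t_connected] serves as induction over the tail: membership in [Q] agrees with that of the root
     for every vertex and edge. *)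
  pose Qe' (e : te (T i)) :=
    Q (gep0 (inr (Tagged (fun i => te (T i)) e)) true) == Q (inl (inl i)).
  pose Qv' (v : tv (T i)) := Q (inr (Tagged (fun i => tv (T i)) v)) == Q (inl (inl i)).
  have [||/(_ v)/eqP //] := @t_connected _ (T i) Qv' Qe'.
    rewrite /Qe' -Qe /=; have := tep_root (troot (T i)) false; rewrite eqxx.
    by case: (tep _ _).
  move=> e b w ew; rewrite /Qv' /Qe'; congr (_ == _).
  by case: b ew => ew; [|rewrite -Qe]; rewrite /= ew.
have Q0 : Q u by exact: connect0.
have all w : Q w = Q (inl (inl i0)).
  by case: w => [s|[i v]]; rewrite ?Qt; exact: Qs.
by move=> v; rewrite -/(Q v) all -(all u).
Qed.

Lemma g_card g : (#|se K| + \sum_i tcyc (T i) + 1 = g + #|I| + #|X|)%N ->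
  (#|edge glue_graph| + 1 = g + #|vert glue_graph|)%N.
Proof.
move=> gE; rewrite !card_sum.
have cs (J : I -> finType) : #|{: {i : I & J i}}| = (\sum_i #|J i|)%N.
  by rewrite card_tagged sumnE big_map big_enum.
rewrite !cs; under eq_bigr => i _ do rewrite t_card.
by rewrite big_split /= [in RHS]addnA [in RHS]addnA -gE
  [X in (_ + X + _)%N]addnC addnA addnAC.
Qed.

(** The summand 1 in [t_inner] accounts for the root, that is, for the string vertex carrying the
    tail. Summing over the tails therefore counts the string vertices as well. *)
Lemma g_card_inner :
  #|[set v : vert glue_graph | is_inner v]| =
  (\sum_i ((tcyc (T i)).*2 + size (tparts (T i))))%N.
Proof.
rewrite -sum1_card big_mkcond /=.
under eq_bigr => v _ do rewrite inE g_inner.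
rewrite !big_sumType /= sum1_card big1 ?addn0 //.
rewrite -[X in (_ + X)%N]/(\sum_p _) sum_sig /=.
rewrite -sum1_card -[LHS]big_split /=; apply: eq_bigr => i _.
by rewrite -t_inner addnC; congr (_ + _)%N; apply: eq_bigr => v _; case: eqP.
Qed.

Lemma g_leaf_count b m :
  (\sum_(e : edge glue_graph) (is_end (endpt e b) && (gweight e == m)) =
   \sum_(i | sg i == b) count_mem m (tparts (T i)) +
   \sum_(e : se K) \sum_x [&& sep e (b (+) (flow e < 0)%R) == inr x & `|flow e|%N == m])%N.
Proof.
rewrite big_sumType /= addnC; congr (_ + _)%N; last first.
  apply: eq_bigr => e _.
  rewrite -[is_end _]negbK -/(is_inner _) g_inner /=.
  case: (sep _ _) => [i|x] /=; first by rewrite big1.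
  rewrite (bigD1 x) //= eqxx big1 ?addn0 // => y.
  by rewrite (inj_eq (@inr_inj _ _)) eq_sym => /negPf ->.
rewrite -[LHS]/(\sum_p _) sum_sig [RHS]big_mkcond /=; apply: eq_bigr => i _.
case: eqP => [sb|/eqP sb].
  rewrite -t_leaves; apply: eq_bigr => e _.
  rewrite -[is_end _]negbK -/(is_inner _) g_inner /= sb addbN addbb.
  case: (tep e _) => [v|] /=; last by rewrite big1.
  rewrite negbK (bigD1 v) //= eqxx big1 ?addn0 // => y.
  by rewrite eq_Some eq_sym => /negPf ->.
apply: big1 => e _.
have -> : b (+) ~~ sg i = false by move: sb; case: b; case: (sg i).
rewrite -[is_end _]negbK -/(is_inner _) g_inner /=.
by case E: (tep e false) => [v|] //=; rewrite negbK (negPf (tep_start E)).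
Qed.

End Glue.

Lemma leaf_weights_count (R : realType) (L : layout R) b m :
  count_mem m (@leaf_weights _ (lmap L) (if b then +oo%E else -oo%E)) =
  (\sum_(e : edge L) (is_end (endpt e b) && (lweight e == m)))%N.
Proof.
rewrite lmap_leaf_weights count_map count_filter -size_filter.
rewrite -[LHS]sum1_size big_filter big_enum_cond /= [LHS]big_mkcond.
apply: eq_bigr => e _ /=.
have -> : [exists c, is_end (endpt e c) &&
    (lpos (endpt e c) == (if b then +oo%E else -oo%E))] = is_end (endpt e b).
  apply/existsP/idP => [[c /andP[ec /eqP]]|eb].
    by case: b c ec => [] [] // ec; rewrite ?(lpos_end_true ec) ?(lpos_end_false ec).
  exists b; rewrite eb /=.
  by case: b eb => eb; rewrite ?(lpos_end_true eb) ?(lpos_end_false eb).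
by rewrite andbC; case: (_ && _).
Qed.

Lemma perm_eq_count_mem (A : eqType) (s t : seq A) :
  (forall x, count_mem x s = count_mem x t) -> perm_eq s t.
Proof. by move=> h; apply/allP => x _ /=; rewrite h. Qed.

Lemma connect_closed (A : finType) (e : rel A) (Q : pred A) x y :
  (forall x y, Q x -> e x y -> Q y) -> connect e x y -> Q x -> Q y.
Proof.
move=> clQ /connectP[p]; elim: p x => [|z p IHp] x /=; first by move=> _ ->.
by move=> /andP[xz pz] yl Qx; apply: (IHp z) => //; exact: clQ xz.
Qed.

Lemma cell_step_sym (R : realType) (phi : plmap R) (A : {set cell phi}) :
  connect_sym (cell_step A).
Proof.
apply: sym_connect_sym => x y; rewrite /cell_step andbCA; congr [&& _, _ & _].
by case: x; case: y.
Qed.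

Lemma cell_step_endpt (R : realType) (phi : plmap R) (A : {set cell phi}) e b :
  ecell e \in A -> vcell (endpt e b) \in A ->
  connect (cell_step A) (ecell e) (vcell (endpt e b)).
Proof.
move=> eA vA; apply: connect1; rewrite /cell_step eA vA /=.
by apply/existsP; exists b.
Qed.

(** * The glued cover is a zigzag cover *)

Section GlueZigzag.
Variables (I X : finType) (k : I -> nat) (sg : I -> bool).
Variables (K : skeleton X k sg) (T : forall i, tail (k i)).
Hypothesis k_gt0 : forall i, (0 < k i)%N.
Hypothesis T_tail : forall i, is_chain (T i) \/ is_even_leaf (T i).
Variable i0 : I.
Local Notation G := (glue_graph K T).
Variables (R : realType) (pos : vert G -> \bar R).
Hypothesis pos_fin_num : forall v, (pos v \is a fin_num) = is_inner v.
Hypothesis pos_end : forall v, is_end v ->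
  pos v = if gside v then +oo%E else -oo%E.
Hypothesis pos_lt : forall e : edge G,
  (pos (endpt e false) < pos (endpt e true))%E.

Definition glayout : layout R := Layout (g_connected K T i0)
  (@g_no_two_valent _ _ _ _ K T) (@gweight_gt0 _ _ _ _ K T k_gt0) pos_fin_num pos_lt.

Let phi := lmap glayout.

Definition string_cells : {set cell phi} :=
  [set x : cell phi | match x with
           | inl (inl _) | inr (inl _) => true
           | _ => false
           end].

Lemma gep_inner (e : edge G) b i : endpt e b = inl (inl i) :> vert G ->
  match e with
  | inl s => sep s (b (+) (flow s < 0)) = inl i
  | inr p => troot (T (tag p)) = tagged p /\ b = ~~ sg (tag p)
  end.
Proof.
case: e => [s|[j e]] /= => [[]//|].
case E: (tep _ _) => [|] // _.
move/eqP: E; rewrite tep_root => /andP[/eqP -> h]; split=> //.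
by move: h; case: b; case: (sg j).
Qed.

(** The partner edge would join the same two string vertices. A tail edge meets the string only at
    the root half-edge, so the partner lies on the string as well, where [s_no_cycle] forbids it. *)
Lemma string_no_cycle (e e' : edge phi) : ecell e \in string_cells ->
  ~ symmetric_cycle e e'.
Proof.
rewrite inE; case: e => // e _ [/eqP ne /andP[nl _] [u [v /andP[juv juv']]] _ _].
move: juv juv' => /existsP[b /andP[/eqP ub /eqP vb]] /existsP[b' /andP[/eqP ub' /eqP vb']].
have in_inl c : exists i, endpt (inl e : edge G) c = inl (inl i) :> vert G.
  have : is_inner (endpt (inl e : edge G) c).
    by move: nl; rewrite negb_or => /andP[]; case: c.
  by rewrite g_inner /=; case: (sep _ _) => [i|] // _; exists i.
have [i iE] := in_inl b; have [j jE] := in_inl (~~ b).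
have ui : u = inl (inl i) by rewrite -ub -iE.
have vj : v = inl (inl j) by rewrite -vb -jE.
have /gep_inner := iE; have /gep_inner := jE; rewrite /= addNb => jS iS.
rewrite ui in ub'; rewrite vj in vb'.
have := gep_inner ub'; have := gep_inner vb'.
case: e' ne ub' vb' => [e'|p] ne ub' vb'.
  rewrite addNb => jS' iS'; apply: ne; congr inl.
  exact: s_no_cycle iS jS iS' jS'.
by move=> [_ h] [_]; rewrite -h; case: (b').
Qed.

(** The root edge of a tail has even weight, so a partner of odd weight lies on the string, and
    [s_no_fork] applies. *)
Lemma string_no_fork (e e' : edge phi) : ecell e \in string_cells ->
  ~ (symmetric_fork e e' /\ odd (weight e)).
Proof.
rewrite inE; case: e => // e _ [[/eqP ne /andP[lf lf'] [v iv]]].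
move=> /andP[/existsP[b /eqP bv] /existsP[b' /eqP bv']] we img we_odd.
have [i vE] : exists i, v = inl (inl i) :> vert G.
  move: iv; rewrite -bv g_inner /=; case: (sep _ _) => [i|] // _.
  by exists i.
have endN (f : edge G) c : is_leaf f -> endpt f c = v -> is_end (endpt f (~~ c)).
  move=> lff fc; have: ~~ is_end (endpt f c) by rewrite fc; exact: iv.
  by move: lff; rewrite /is_leaf; case: c {fc} => /=; case: (is_end _) => //=;
    case: (is_end _).
(* Each leaf maps onto the ray from [pos v] to its end; the points at distance 1 on either side of
   [pos v] tell the two possible rays apart. *)
have eb : b = b'.
  have /fineK vK : pos v \is a fin_num by rewrite pos_fin_num; exact: iv.
  have img' y : (pos (endpt (inl e : edge G) false) <= y%:E
        <= pos (endpt (inl e : edge G) true))%E =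
      (pos (endpt (e' : edge G) false) <= y%:E <= pos (endpt (e' : edge G) true))%E.
    have h : edge_image (inl e : edge phi) y <-> edge_image (e' : edge phi) y.
      by rewrite img.
    apply/idP/idP => h1.
      by apply/(@lmap_edge_image _ glayout e')/h/(@lmap_edge_image _ glayout (inl e)).
    by apply/(@lmap_edge_image _ glayout (inl e))/h/(@lmap_edge_image _ glayout e').
  have posE (f : edge G) c : is_leaf f -> endpt f c = v ->
      pos (endpt f (~~ c)) = if c then -oo%E else +oo%E.
    move=> lff fc; have en := endN f c lff fc.
    by rewrite pos_end // gside_end //; case: c {fc en}.
  have P1 := posE _ _ lf bv; have P2 := posE _ _ lf' bv'.
  have := img' (fine (pos v) + 1); have := img' (fine (pos v) - 1).
  case: b b' bv bv' P1 P2 vK => [] [] // bv bv' /= -> -> vK;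
    move: bv bv' => /= -> ->; rewrite leey leNye /= ?andbT -vK !lee_fin.
    by rewrite gerBl ler01 lerBrDl gerDr ler10.
  by rewrite lerBrDl gerDr ler10 gerBl ler01.
subst b'.
have := gep_inner (etrans bv vE); rewrite /= => iS.
have /gep_inner := etrans bv' vE.
have [x xS] : exists x, sep e (~~ (b (+) (flow e < 0))) = inr x.
  have := endN _ _ lf bv; rewrite -[is_end _]negbK -/(is_inner _) g_inner /= addNb.
  by case: (sep _ _) => // x _; exists x.
case: e' ne lf' we img bv' => [e'|[j e']] ne lf' we img bv'; last first.
  move=> [/= rE _]; move: we_odd; rewrite we /= -rE tw_root.
  by rewrite odd_double.
move=> iS'.
have [y yS] : exists x, sep e' (~~ (b (+) (flow e' < 0))) = inr x.
  have := endN _ _ lf' bv'; rewrite -[is_end _]negbK -/(is_inner _) g_inner /= addNb.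
  by case: (sep _ _) => // x' _; exists x'.
apply: ne; congr inl; apply: (s_no_fork iS xS iS' yS) => //.
by rewrite (sside_flow xS) (sside_flow yS) -!addNb !addbK.
Qed.

Lemma string_is_string : is_string string_cells.
Proof.
apply/and4P; split.
- apply/forallP => e; apply/implyP; rewrite inE; case: e => // e _.
  by apply/forallP => b; rewrite inE.
- have sv s : vcell (inl s : vert phi) \in string_cells by rewrite inE.
  have sE e : ecell (inl e : edge phi) \in string_cells by rewrite inE.
  have eE e b : connect (cell_step string_cells) (ecell (inl e : edge phi))
       (vcell (inl (sep e b) : vert phi)).
    have -> : (inl (sep e b) : vert phi) =
        endpt (inl e : edge phi) (b (+) (flow e < 0)) by rewrite /= addbK.
    by apply: cell_step_endpt; rewrite ?sE //= addbK sv.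
  have cv s t : connect (cell_step string_cells) (vcell (inl s : vert phi))
      (vcell (inl t : vert phi)).
    pose Q t := connect (cell_step string_cells) (vcell (inl s : vert phi))
      (vcell (inl t : vert phi)).
    apply: (@s_connected _ _ _ _ K Q _ s t); last exact: connect0.
    move=> e; apply: (same_connect_r (cell_step_sym _)).
    apply: (connect_trans _ (eE e true)).
    by rewrite cell_step_sym; exact: eE.
  have toS x : x \in string_cells -> exists s,
      connect (cell_step string_cells) x (vcell (inl s : vert phi)).
    rewrite inE; case: x => [[s|]|[e|]] // _; first by exists s; exact: connect0.
    by exists (sep e true); exact: eE.
  apply/forallP => x; apply/implyP => /toS[s xs].
  apply/forallP => y; apply/implyP => /toS[t yt].
  apply: (connect_trans xs); apply: (connect_trans (cv s t)).
  by rewrite cell_step_sym.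
- have [e _] : exists e : se K, true.
    have := sval2 K i0; rewrite /rooted_valence.
    case: (pickP (fun _ : se K => true)) => [e _ _|e0]; first by exists e.
    by rewrite big_pred0.
  by apply/existsP; exists (inl e); rewrite inE.
- apply/forallP => v; apply/implyP => /andP[iv]; rewrite inE.
  case: v iv => // -[i|x] iv _; last by move: iv; rewrite g_inner.
  rewrite -sum1_card big_mkcond /=.
  under eq_bigr => h _ do rewrite 2!inE.
  rewrite -(pair_bigA _ (fun (e : edge phi) b => if (endpt e b == inl (inl i)) &&
     match e with inl _ => true | inr _ => false end then 1 else 0)%N) /=.
  rewrite big_sumType /= [X in (_ + X)%N]big1 ?addn0; last first.
    by move=> p _; rewrite big_bool !andbF.
  apply/eqP; rewrite -[RHS](sval2 K i) /rooted_valence; apply: eq_bigr => e _.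
  rewrite big_bool !andbT /= !eq_Some.
  have inlE b : (inl (sep e b) == inl (inl i) :> vert phi) = (sep e b == inl i) by [].
  by case: (flow e < 0) => /=; rewrite !inlE; case: (sep e false == _); case: (sep e true == _).
Qed.

Lemma string_odd (e : edge phi) : ecell e \in string_cells -> odd (weight e).
Proof. by rewrite inE; case: e => // e _; exact: flow_odd. Qed.

Section TailComponent.
Variable i : I.

Definition giv (v : tv (T i)) : vert phi := inr (Tagged (fun i => tv (T i)) v).
Definition gie (e : te (T i)) : edge phi := inr (Tagged (fun i => te (T i)) e).

Lemma glue_embedding :
  @tail_embedding R phi _ (T i) (inl (inl i)) (~~ sg i) giv gie.
Proof.
split.
- move=> u v uv; have {uv}uv := inr_inj uv; apply/eqP.
  by move/eqP: uv; rewrite eq_Tagged.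
- move=> u v uv; have {uv}uv := inr_inj uv; apply/eqP.
  by move/eqP: uv; rewrite eq_Tagged.
- by move=> e b; rewrite /= addbK; case: (tep e b).
- by [].
- by move=> v; rewrite /is_end gvalence.
- by move=> u v eu ev; rewrite /= !pos_end.
- by move=> e e'; exact: (@lmap_edge_image_eq _ glayout).
Qed.

Let A := tail_cells giv gie.

Lemma tail_vcell (p : {i : I & tv (T i)}) : (vcell (inr p : vert phi) \in A) = (tag p == i).
Proof.
rewrite inE; apply/codomP/eqP => [[v [->]]|] //.
by case: p => j v /= ji; subst j; exists v.
Qed.

Lemma tail_ecell (p : {i : I & te (T i)}) : (ecell (inr p : edge phi) \in A) = (tag p == i).
Proof.
rewrite inE; apply/codomP/eqP => [[v [->]]|] //.
by case: p => j v /= ji; subst j; exists v.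
Qed.

(** Away from the string, the cells incident to a cell of the tail belong to the same tail, so the
    component does not leave it; conversely [t_connected] reaches every cell of the tail from its
    root edge. *)
Lemma tail_component x : x \in A -> cells_component (~: string_cells) x = A.
Proof.
move=> xA; apply/setP => y; rewrite inE; apply/idP/idP => [xy|yA].
  apply: (connect_closed (Q := fun z => z \in A) _ xy xA) => {}x {}y {}xA {xy}.
  rewrite /cell_step => /and3P[_ yS inc]; move: yS; rewrite finset.in_setC inE.
  case: x y xA inc => [v|e] [u|f] //= xA /existsP[b /eqP ev].
    case: f ev => // p <- in xA * => _; case: p xA => j f /=.
    case: (tep _ _) => [w|]; last by rewrite inE => /codomP[].
    by rewrite -/(vcell _) -/(ecell _) tail_vcell tail_ecell.
  case: e xA ev => [e|[j e]]; first by rewrite inE => /codomP[].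
  rewrite -/(ecell _) tail_ecell /= => /eqP ji <-.
  case: (tep _ _) => [w|] //= _.
  by rewrite -/(vcell _) tail_vcell; apply/eqP.
pose B := ~: string_cells.
pose r := ecell (gie (troot (T i))).
have eB e : ecell (gie e) \in B by rewrite !inE.
have vB v : vcell (giv v) \in B by rewrite !inE.
have [||Hv He] := @t_connected _ (T i)
  (fun v => connect (cell_step B) r (vcell (giv v)))
  (fun e => connect (cell_step B) r (ecell (gie e))).
- exact: connect0.
- move=> e b v ev; apply: (same_connect_r (cell_step_sym _)).
  rewrite cell_step_sym.
  have <- : endpt (gie e) (b (+) ~~ sg i) = giv v by rewrite /= addbK ev.
  by apply: cell_step_endpt; rewrite //= addbK ev; exact: vB.
have rA z : z \in A -> connect (cell_step B) r z.
  by rewrite inE; case: z => z /codomP[w ->]; [exact: Hv|exact: He].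
by apply: (connect_trans _ (rA _ yA)); rewrite cell_step_sym; exact: rA.
Qed.

End TailComponent.

Lemma glayout_is_zigzag : is_zigzag phi.
Proof.
exists string_cells; split.
- by move=> e e' eS; split; [exact: string_no_cycle|exact: string_no_fork].
- by left; split; [exact: string_is_string|exact: string_odd].
move=> x xS.
have [i xi] : exists i, x \in tail_cells (@giv i) (@gie i).
  move: xS; rewrite inE; case: x => [[//|p]|[//|p]] _; exists (tag p).
    by rewrite -/(vcell _) tail_vcell.
  by rewrite -/(ecell _) tail_ecell.
rewrite (tail_component xi).
exists (inl (inl i)); first by rewrite inE.
by case: (T_tail i) => h; [left|right]; exact: h (glue_embedding i).
Qed.

End GlueZigzag.

Lemma zigzag_cover_of_skeleton (R : realType) (I X : finType) (k : I -> nat)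
    (sg : I -> bool) (K : skeleton X k sg) (T : forall i, tail (k i))
    (g d : nat) (lam mu : seq nat) (P : seq R) (i0 : I) :
  (forall i, (0 < k i)%N) ->
  (forall i, is_chain (T i) \/ is_even_leaf (T i)) ->
  (#|se K| + \sum_i tcyc (T i) + 1 = g + #|I| + #|X|)%N ->
  uniq P -> size P = (\sum_i ((tcyc (T i)).*2 + size (tparts (T i))))%N ->
  sumn lam = d ->
  (forall b m, count_mem m (if b then mu else lam) =
   \sum_(i | sg i == b) count_mem m (tparts (T i)) +
   \sum_(e : se K) \sum_x [&& sep e (b (+) (flow e < 0)%R) == inr x & `|flow e|%N == m])%N ->
  exists phi : plmap R, zigzag_cover phi g d lam mu P.
Proof.
move=> k_gt0 T_tail gE uP sP lamE cntE.
have [pos [pf pe plt pP]] := positions_of_heights (P := P)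
  (@gheight_lt _ _ _ _ K T) (@gside_end _ _ _ _ K T) uP
  (etrans sP (esym (g_card_inner K T))).
exists (lmap (glayout k_gt0 i0 pf plt)); split; last exact: glayout_is_zigzag.
apply: lmap_cover => //.
- exact: g_balanced.
- exact: g_card.
- apply: perm_eq_count_mem => m.
  apply: (etrans (leaf_weights_count (glayout k_gt0 i0 pf plt) false m)).
  by rewrite (cntE false); exact: g_leaf_count.
- apply: perm_eq_count_mem => m.
  apply: (etrans (leaf_weights_count (glayout k_gt0 i0 pf plt) true m)).
  by rewrite (cntE true); exact: g_leaf_count.
Qed.

(** * Paths and loops *)

(* [(right, forked, k)]: a tail of weight [2k] on the given side, ending in a
   fork of weight [k] or in a leaf. *)
Definition tail_spec : Type := bool * bool * nat.

Definition spec_right (u : tail_spec) : bool := u.1.1.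
Definition spec_forked (u : tail_spec) : bool := u.1.2.
Definition spec_half (u : tail_spec) : nat := u.2.

Definition spec_parts (u : tail_spec) : seq nat :=
  if spec_forked u then [:: spec_half u; spec_half u] else [:: (spec_half u).*2].

Definition spec_ok (u : tail_spec) : bool :=
  (0 < spec_half u)%N && (spec_forked u ==> odd (spec_half u)).

(* The rightward flow that enters the string from the tail. *)
Definition spec_flow (u : tail_spec) : int :=
  if spec_right u then - (spec_half u).*2%:Z else (spec_half u).*2%:Z.

Definition spec_tail (u : tail_spec) (c : nat) : tail (spec_half u) :=
  if spec_forked u then iter c (@cycle_tail (spec_half u)) (fork_tail (spec_half u))
  else leaf_tail (spec_half u).

Lemma spec_tail_cyc u c :
  tcyc (spec_tail u c) = if spec_forked u then c else 0%N.
Proof. by rewrite /spec_tail; case: (spec_forked u) => //; elim: c => //= c ->. Qed.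

Lemma spec_tail_parts u c : tparts (spec_tail u c) = spec_parts u.
Proof.
rewrite /spec_tail /spec_parts; case: (spec_forked u) => //.
by elim: c => //= c ->.
Qed.

Lemma spec_tailP u c : spec_ok u ->
  is_chain (spec_tail u c) \/ is_even_leaf (spec_tail u c).
Proof.
rewrite /spec_ok /spec_tail; case: (spec_forked u) => /andP[_ /=] ok.
  by left; elim: c => [|c IHc]; [exact: fork_tail_is_chain|exact: cycle_tail_is_chain].
by right; exact: leaf_tail_is_even_leaf.
Qed.

Definition total_flow (us : seq tail_spec) : int := \sum_(u <- us) spec_flow u.

Lemma total_flow_take x0 us i : (i < size us)%N ->
  total_flow (take i.+1 us) = total_flow (take i us) + spec_flow (nth x0 us i).
Proof.
by move=> h; rewrite (take_nth x0) // /total_flow -cats1 big_cat big_seq1.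
Qed.

Lemma odd_abszD (a b : int) : odd `|a + b| = odd `|a| (+) odd `|b|.
Proof. lia. Qed.

Lemma even_total_flow us : odd `|total_flow us| = false.
Proof.
rewrite /total_flow; elim: us => [|u us IHus]; first by rewrite big_nil.
rewrite big_cons odd_abszD IHus addbF /spec_flow.
by case: (spec_right u); rewrite ?abszN odd_double.
Qed.

Definition nth_spec (us : seq tail_spec) (i : 'I_(size us)) : tail_spec :=
  tnth (in_tuple us) i.

Lemma nth_specE us (i : 'I_(size us)) x0 : nth_spec i = nth x0 us i.
Proof. by rewrite /nth_spec (tnth_nth x0). Qed.

Lemma spec_flow_nth us (i : 'I_(size us)) :
  total_flow (take i us) - total_flow (take i.+1 us) =
  if spec_right (nth_spec i) then (spec_half (nth_spec i)).*2%:Z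
  else - (spec_half (nth_spec i)).*2%:Z.
Proof.
rewrite (total_flow_take (nth_spec i)) // opprD addrA subrr sub0r -nth_specE.
by rewrite /spec_flow; case: spec_right; rewrite ?opprK.
Qed.

Section Path.
Variables (us : seq tail_spec) (e0 e1 : bool * nat).

(** The flow that enters the string at this end: a part of [lam] is a source, a part of [mu] a
    sink. *)
Definition end_flow (e : bool * nat) : int := if e.1 then - e.2%:Z else e.2%:Z.

Hypothesis e0_odd : odd e0.2.
Hypothesis e1_odd : odd e1.2.
Hypothesis flow_sum : end_flow e0 + total_flow us + end_flow e1 = 0.
(** With a single tail both edges of the path are leaves at the same vertex, and they form a
    symmetric fork exactly when the two ends agree in side and weight. *)
Hypothesis no_fork : (1 < size us)%N \/ e0 != e1.

Local Notation n := (size us).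

Definition path_flow (m : nat) : int := end_flow e0 + total_flow (take m us).

(** Edge [m] runs from vertex [m - 1] to vertex [m] and carries [path_flow m]. [unlift] fails
    precisely where such a vertex is missing, at the two extremities [inr false] and [inr true]. The
    boolean names the position on the path; whether the end lies left or right is decided by
    [path_side]. *)
Definition path_ep (e : 'I_n.+1) (b : bool) : 'I_n + bool :=
  if b then (if unlift ord_max e is Some i then inl i else inr true)
  else (if unlift ord0 e is Some i then inl i else inr false).

Arguments path_ep : simpl never.

(** Each inner edge contributes a step of 1 or -1 in the direction of its flow, so flow times height
    difference is the absolute value of the flow. A path has no cycle that could make these steps
    inconsistent. *)
Definition path_height (i : 'I_n) : int := \sum_(j < i) Num.sg (path_flow j.+1).

(** An extremity is on the right iff the flow runs into it: at the far end this is a positive flow,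
    at the near end a negative one. *)
Definition path_side (x : bool) : bool :=
  if x then ~~ (path_flow n < 0) else path_flow 0 < 0.

Lemma path_flow_odd m : odd `|path_flow m|.
Proof.
rewrite /path_flow odd_abszD even_total_flow addbF /end_flow.
by case: (e0.1); rewrite ?abszN.
Qed.

Lemma path_flow0 : path_flow 0 = end_flow e0.
Proof. by rewrite /path_flow take0 /total_flow big_nil addr0. Qed.

Lemma path_flown : path_flow n = - end_flow e1.
Proof. by rewrite /path_flow take_size; apply/eqP; rewrite -addr_eq0 flow_sum. Qed.

Lemma path_ep_true i : path_ep (lift ord_max i) true = inl i.
Proof. by rewrite /path_ep liftK. Qed.
Lemma path_ep_true_max : path_ep ord_max true = inr true.
Proof. by rewrite /path_ep unlift_none. Qed.
Lemma path_ep_false i : path_ep (lift ord0 i) false = inl i.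
Proof. by rewrite /path_ep liftK. Qed.
Lemma path_ep_false0 : path_ep ord0 false = inr false.
Proof. by rewrite /path_ep unlift_none. Qed.

Lemma path_ep_inl e b i : path_ep e b = inl i -> (e : nat) = (i + ~~ b)%N.
Proof.
case: b; rewrite /path_ep; case: unliftP => // j -> [->].
  by rewrite lift_max addn0.
by rewrite lift0 addn1.
Qed.

Lemma path_ep_inr e b x : path_ep e b = inr x -> x = b /\ e = (if b then ord_max else ord0).
Proof. by case: b; rewrite /path_ep; case: unliftP => // -> [<-]. Qed.

Lemma path_sum_inl (S : nmodType) (f : 'I_n.+1 -> S) b i :
  \sum_e f e *+ (path_ep e b == inl i) = f (lift (if b then ord_max else ord0) i).
Proof.
case: b.
  rewrite (bigD1_ord ord_max) //= path_ep_true_max mulr0n add0r.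
  rewrite (bigD1 i) //= path_ep_true eqxx mulr1n big1 ?addr0 // => j /negPf ji.
  by rewrite path_ep_true eq_inl ji.
rewrite (bigD1_ord ord0) //= path_ep_false0 mulr0n add0r.
rewrite (bigD1 i) //= path_ep_false eqxx mulr1n big1 ?addr0 // => j /negPf ji.
by rewrite path_ep_false eq_inl ji.
Qed.

Lemma path_sum_inr (S : nmodType) (f : 'I_n.+1 -> S) b x :
  \sum_e f e *+ (path_ep e b == inr x) =
  f (if b then ord_max else ord0) *+ (x == b).
Proof.
case: b.
  rewrite (bigD1_ord ord_max) //= path_ep_true_max big1 ?addr0.
    by rewrite eq_inr eq_sym.
  by move=> j _; rewrite path_ep_true.
rewrite (bigD1_ord ord0) //= path_ep_false0 big1 ?addr0.
  by rewrite eq_inr eq_sym.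
by move=> j _; rewrite path_ep_false.
Qed.

Definition path_skeleton : @skeleton 'I_n bool (fun i => spec_half (nth_spec i))
  (fun i => spec_right (nth_spec i)).
Proof.
refine (@Skeleton _ _ _ _ 'I_n.+1 path_ep (fun e => path_flow e) path_height
  path_side _ _ _ _ _ _ _ _ _).
- by move=> e; exact: path_flow_odd.
- move=> i; rewrite /rooted_valence big_split /= !sum_bool_nat.
  by rewrite (path_sum_inl (fun=> 1%N) false) (path_sum_inl (fun=> 1%N) true).
- move=> x; rewrite /rooted_valence big_split /= !sum_bool_nat.
  rewrite (path_sum_inr (fun=> 1%N) false) (path_sum_inr (fun=> 1%N) true).
  by case: x.
- move=> i; rewrite sumrB (path_sum_inl _ true) (path_sum_inl _ false).
  rewrite lift_max lift0 -spec_flow_nth /path_flow.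
  by rewrite opprD addrACA subrr add0r.
- move=> e i j /path_ep_inl ei /path_ep_inl ej.
  rewrite addn0 in ej; rewrite addn1 in ei.
  rewrite /path_height -ej ei big_ord_recr /= addrAC subrr add0r mulrC -normrEsg.
  by rewrite normr_gt0; have := path_flow_odd i.+1; case: eqP => // ->.
- by move=> e b x /path_ep_inr [-> ->]; case: b.
- move=> Q Qe u v.
  have Qt m (lt : (m < n.+1)%N) : Q (path_ep (Ordinal lt) true) = Q (inr false).
    elim: m lt => [|m IHm] lt; rewrite -Qe.
      by rewrite (_ : Ordinal lt = ord0) ?path_ep_false0 //; exact: val_inj.
    rewrite -(IHm (ltnW lt)).
    rewrite (_ : Ordinal lt = lift ord0 (Ordinal (lt : (m < n)%N))); last first.
      by apply: val_inj.
    rewrite (_ : Ordinal (ltnW lt) = lift ord_max (Ordinal (lt : (m < n)%N))).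
      by rewrite path_ep_false path_ep_true.
    by apply: val_inj; exact/esym/lift_max.
  have QE w : Q w = Q (inr false).
    case: w => [i|[]] //.
      by rewrite -path_ep_true; case: (lift _ _) => m lt; exact: Qt.
    by rewrite -path_ep_true_max; exact: Qt.
  by rewrite !QE.
- move=> e e' i j b b' /path_ep_inl h1 /path_ep_inl h2 /path_ep_inl h3 /path_ep_inl h4.
  by apply: val_inj => /=; move: h1 h2 h3 h4; case: b; case: b'; lia.
- move=> e e' i x x' b b' /path_ep_inl h1 /path_ep_inr[-> h2].
  move=> /path_ep_inl h3 /path_ep_inr[-> h4] hs hw.
  have [bb|nbb] := eqVneq b b'; first by rewrite h2 h4 bb.
  exfalso.
  (* Two different leaves at one vertex are the first and the last edge, so the path has a single
     vertex; equal sides and weights then give [e0 = e1], against [no_fork]. *)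
  have n1 : n = 1%N.
    by move: h1 h2 h3 h4 nbb; case: b {hs}; case: b' => //= h1 h2 h3 h4 _;
      move: h1 h3; rewrite h2 h4 /=; lia.
  case: no_fork; first by rewrite n1.
  case/negP; apply/eqP; move: hs hw; rewrite h2 h4 {h1 h2 h3 h4}.
  have : path_flow 0 = end_flow e0 by exact: path_flow0.
  have : path_flow n = - end_flow e1 by exact: path_flown.
  rewrite /end_flow; move: e0_odd e1_odd nbb; case: e0 => s0 w0; case: e1 => s1 w1.
  rewrite /path_side /=.
  case: b; case: b' => //= o0 o1 _ -> ->; rewrite ?absz_id;
    case: s0; case: s1 => /= h1 h2; try (by move: h1; lia);
    by congr pair; lia.
Defined.

Lemma path_leaf_count b m :
  (\sum_(e : se path_skeleton) \sum_x
     [&& sep e (b (+) (flow e < 0)%R) == inr x & `|flow e|%N == m] =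
   count (pred1 (b, m)) [:: e0; e1])%N.
Proof.
(* The extremity [inr x] can only occur as endpoint [x] of an edge, so the sum over extremities
   becomes a sum over half-edges. *)
have E (e : 'I_n.+1) : (\sum_x [&& path_ep e (b (+) (path_flow e < 0)%R) == inr x
     & `|path_flow e|%N == m] =
   \sum_(c : bool)
     nat_of_bool ((c == b (+) (path_flow e < 0)%R) && (`|path_flow e|%N == m))
       *+ (path_ep e c == inr c))%N.
  rewrite !big_bool.
  have H c : (path_ep e c == inr (~~ c)) = false.
    by apply/eqP => /path_ep_inr[]; case: c.
  have /= Ht := H true; have /= Hf := H false.
  by case: (b (+) _); rewrite ?Ht ?Hf; case: (_ == m);
    rewrite ?andbT ?andbF /= ?mul0rn ?mulr0n ?addn0 ?add0n ?eqxx //; case: (path_ep _ _ == _).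
rewrite /=; under eq_bigr => e _ do rewrite E.
rewrite exchange_big /= big_bool /=.
rewrite (path_sum_inr (fun e : 'I_n.+1 =>
  nat_of_bool ((true == b (+) (path_flow e < 0)) && (`|path_flow e|%N == m))) true true).
rewrite (path_sum_inr (fun e : 'I_n.+1 =>
  nat_of_bool ((false == b (+) (path_flow e < 0)) && (`|path_flow e|%N == m))) false false).
rewrite !eqxx !mulr1n /= path_flow0 path_flown addn0 addnC.
move: e0_odd e1_odd; rewrite /end_flow; case: e0 => s0 w0; case: e1 => s1 w1 /=.
move=> o0 o1; have w0_gt0 := odd_gt0 o0; have w1_gt0 := odd_gt0 o1.
congr (_ + _)%N.
  by case: s0 => /=; rewrite ?abszN ?absz_nat xpair_eqE ?oppr_lt0 ?ltz_nat ?w0_gt0;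
    case: (b).
by case: s1 => /=; rewrite ?opprK ?abszN ?absz_nat xpair_eqE ?oppr_lt0 ?ltz_nat
  ?w1_gt0; case: (b).
Qed.

End Path.

Section Loop.
Variable us : seq tail_spec.
Local Notation n := (size us).
(** On a loop with at least three vertices no two edges share both endpoints, which excludes
    symmetric cycles. *)
Hypothesis n_gt2 : (2 < n)%N.
Hypothesis flow_sum : total_flow us = 0.
Hypothesis flow_gt0 : forall m, (0 < m < n)%N -> 0 < total_flow (take m us).

Definition loop_ep (e : 'I_n) (b : bool) : 'I_n + void :=
  inl (if b then ordS e else e).

(* The partial sums of the flow are even and positive before the last one, so
   all edges of the loop but the last point forwards. *)
Definition loop_flow (m : nat) : int := total_flow (take m.+1 us) - 1.

Lemma loop_flow_odd m : odd `|loop_flow m|.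
Proof. by rewrite /loop_flow odd_abszD even_total_flow. Qed.

Lemma loop_flow_gt0 m : (m.+1 < n)%N -> 0 < loop_flow m.
Proof.
move=> h; have := flow_gt0 (m := m.+1) h; have := loop_flow_odd m.
by rewrite /loop_flow; lia.
Qed.

Lemma loop_flow_last : loop_flow n.-1 = -1.
Proof. by rewrite /loop_flow prednK ?take_size ?flow_sum //; exact: ltn_trans n_gt2. Qed.

Lemma loop_ep_inl (e : 'I_n) b i : loop_ep e b = inl i ->
  if b then (i : nat) = (if (e.+1 < n)%N then e.+1 else 0%N) else (i : nat) = e.
Proof.
case: b => -[<-] //=; case: ltnP => h; first by rewrite modn_small.
have -> : e.+1 = n by apply/eqP; rewrite eqn_leq h ltn_ord.
by rewrite modnn.
Qed.

Lemma loop_sum (S : nmodType) (f : 'I_n -> S) b i :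
  \sum_e f e *+ (loop_ep e b == inl i) = f (if b then ord_pred i else i).
Proof.
have E e : (loop_ep e b == inl i) = (e == if b then ord_pred i else i).
  by case: b; rewrite eq_inl // (can2_eq (@ordSK n) (@ord_predK n)).
under eq_bigr => e _ do rewrite E.
by rewrite (bigD1 (if b then ord_pred i else i)) //= eqxx mulr1n big1 ?addr0 // => e /negPf ->.
Qed.

Definition loop_skeleton : @skeleton 'I_n void (fun i => spec_half (nth_spec i))
  (fun i => spec_right (nth_spec i)).
Proof.
refine (@Skeleton _ _ _ _ 'I_n loop_ep (fun e => loop_flow e) (fun i => (i : nat)%:Z)
  (of_void _) _ _ _ _ _ _ _ _ _).
- by move=> e; exact: loop_flow_odd.
- move=> i; rewrite /rooted_valence big_split /= !sum_bool_nat.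
  by rewrite (loop_sum (fun=> 1%N) false) (loop_sum (fun=> 1%N) true).
- by case.
- move=> i; rewrite sumrB (loop_sum _ true) (loop_sum _ false) -spec_flow_nth.
  (* At vertex 0 the preceding edge is the closing one; [flow_sum] identifies the full sum with the
     empty sum. *)
  have H : total_flow (take (ord_pred i).+1 us) = total_flow (take i us).
    case: i => -[|i] lt /=.
      rewrite add0n modn_small ?prednK; try lia.
      by rewrite take_size take0 flow_sum /total_flow big_nil.
    by rewrite modnDr modn_small //; exact: ltnW.
  by rewrite /loop_flow H opprB addrA subrK.
- move=> e i j /loop_ep_inl ie /loop_ep_inl je; rewrite ie je.
  case: ltnP => h.
    by rewrite mulr_gt0 ?loop_flow_gt0 // -addn1 PoszD addrAC subrr.
  (* The closing edge goes from vertex [n.-1] to vertex 0 with flow -1, so along the flow it climbs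
     from 0 to [n.-1]. *)
  have -> : (e : nat) = n.-1 by have := ltn_ord e; lia.
  by rewrite loop_flow_last; lia.
- by move=> e b [].
- move=> Q Qe u v.
  have n_gt0 : (0 < n)%N by lia.
  have Q0 m (lt : (m < n)%N) : Q (inl (Ordinal lt)) = Q (inl (Ordinal n_gt0)).
    elim: m lt => [|m IHm] lt; first by congr (Q (inl _)); exact: val_inj.
    rewrite -(IHm (ltnW lt)) -[in RHS]/(loop_ep (Ordinal (ltnW lt)) false) Qe.
    congr (Q (inl _)); apply: val_inj => /=.
    by rewrite modn_small.
  have QE w : Q w = Q (inl (Ordinal n_gt0)) by case: w => [[m lt]|[]].
  by rewrite !QE.
- move=> e e' i j b b' /loop_ep_inl h1 /loop_ep_inl h2 /loop_ep_inl h3 /loop_ep_inl h4.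
  apply: val_inj => /=; have := ltn_ord e; have := ltn_ord e'.
  move: h1 h2 h3 h4; case: b; case: b' => /=; case: (ltnP e.+1 n); case: (ltnP e'.+1 n); lia.
- by move=> e e' i [].
Defined.

End Loop.

(** * Leaf weights and flow balance of a list of tails *)

Section TypeOfSpecs.
Variables (us : seq tail_spec) (ends : seq (bool * nat)) (lam mu : seq nat).

Definition specs_type : Prop := forall b : bool,
  perm_eq (if b then mu else lam)
    (flatten [seq spec_parts u | u <- us & spec_right u == b] ++
     [seq e.2 | e <- ends & e.1 == b]).

Hypothesis typeE : specs_type.

Lemma specs_count b m : count_mem m (if b then mu else lam) =
  (\sum_(u <- us | spec_right u == b) count_mem m (spec_parts u) +
   count (pred1 (b, m)) ends)%N.
Proof.
rewrite (permP (typeE b)) count_cat count_flatten -map_comp sumnE big_map big_filter.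
congr (_ + _)%N; rewrite count_map count_filter; apply: eq_count => -[s w] /=.
by rewrite xpair_eqE andbC.
Qed.

Lemma specs_sumn b : sumn (if b then mu else lam) =
  (\sum_(u <- us | spec_right u == b) (spec_half u).*2 +
   \sum_(e <- ends | e.1 == b) e.2)%N.
Proof.
rewrite (perm_sumn (typeE b)) sumn_cat sumn_flatten -map_comp !sumnE !big_map !big_filter.
congr (_ + _)%N; apply: eq_bigr => u _; rewrite /= /spec_parts.
by case: spec_forked; rewrite /= ?addn0 ?addnn.
Qed.

Lemma specs_size : (size lam + size mu =
  \sum_(u <- us) size (spec_parts u) + size ends)%N.
Proof.
have E b : size (if b then mu else lam) =
  (\sum_(u <- us | spec_right u == b) size (spec_parts u) +
   count (fun e => e.1 == b) ends)%N.
  rewrite (perm_size (typeE b)) size_cat size_flatten /shape -map_comp.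
  by rewrite sumnE big_map big_filter size_map size_filter.
rewrite (E false) (E true) [in RHS](bigID (fun u => spec_right u == true)) /=.
rewrite -(count_predC (fun e : bool * nat => e.1 == true) ends).
have -> : (\sum_(u <- us | spec_right u == false) size (spec_parts u) =
   \sum_(u <- us | spec_right u != true) size (spec_parts u))%N.
  by apply: eq_bigl => u; case: spec_right.
have -> : count (fun e : bool * nat => e.1 == false) ends =
   count (predC (fun e : bool * nat => e.1 == true)) ends.
  by apply: eq_count => -[[] w].
by lia.
Qed.

Lemma specs_flow : sumn lam = sumn mu ->
  total_flow us + \sum_(e <- ends) end_flow e = 0.
Proof.
move=> h; have := specs_sumn false; have := specs_sumn true => /=; rewrite -h => -> sumE.
rewrite /total_flow (bigID (fun u => spec_right u == true)) /=.
rewrite [\sum_(e <- ends) _](bigID (fun e => e.1 == true)) /=.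
have -> : \sum_(u <- us | spec_right u == true) spec_flow u =
    - (\sum_(u <- us | spec_right u == true) (spec_half u).*2)%N%:Z.
  rewrite (big_morph Posz PoszD (erefl 0%:Z)) -sumrN; apply: eq_bigr => u /eqP ur.
  by rewrite /spec_flow ur.
have -> : \sum_(u <- us | spec_right u != true) spec_flow u =
    (\sum_(u <- us | spec_right u == false) (spec_half u).*2)%N%:Z.
  rewrite (big_morph Posz PoszD (erefl 0%:Z)); apply: eq_big => u; rewrite /spec_flow;
    by case: spec_right.
have -> : \sum_(e <- ends | e.1 == true) end_flow e =
    - (\sum_(e <- ends | e.1 == true) e.2)%N%:Z.
  rewrite (big_morph Posz PoszD (erefl 0%:Z)) -sumrN; apply: eq_bigr => e /eqP er.
  by rewrite /end_flow er.
have -> : \sum_(e <- ends | e.1 != true) end_flow e =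
    (\sum_(e <- ends | e.1 == false) e.2)%N%:Z.
  rewrite (big_morph Posz PoszD (erefl 0%:Z)); apply: eq_big => -[s w]; rewrite /end_flow /=;
    by case: s.
by lia.
Qed.

End TypeOfSpecs.

(** The alternative [G == 0] is for genus 0, where the only forked pair may have been spent on the
    ends of the string. *)
Lemma cycle_distribution (us : seq tail_spec) (G : nat) : (0 < size us)%N ->
  (G == 0%N) || has spec_forked us ->
  exists c : 'I_(size us) -> nat,
    (\sum_i tcyc (spec_tail (nth_spec i) (c i)))%N = G.
Proof.
move=> us_gt0 hG.
have [i iG] : exists i : 'I_(size us), (G == 0%N) || spec_forked (nth_spec i).
  case/orP: hG => [->|/hasP[u uu uf]]; first by exists (Ordinal us_gt0).
  have lt : (index u us < size us)%N by rewrite index_mem.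
  by exists (Ordinal lt); rewrite (nth_specE _ u) nth_index // uf orbT.
exists (fun j => if j == i then G else 0%N).
rewrite (bigD1 i) //= eqxx spec_tail_cyc big1 ?addn0.
  by move: iG; case: spec_forked => //; rewrite orbF => /eqP.
by move=> j /negPf ji; rewrite ji spec_tail_cyc; case: spec_forked.
Qed.

Section SpecCovers.
Variables (R : realType) (us : seq tail_spec) (ends : seq (bool * nat)).
Variables (lam mu : seq nat) (G : nat) (P : seq R).
Hypothesis typeE : specs_type us ends lam mu.
Hypothesis us_ok : all spec_ok us.
Hypothesis us_gt0 : (0 < size us)%N.
Hypothesis G_forked : (G == 0%N) || has spec_forked us.
Hypothesis P_uniq : uniq P.

Lemma zigzag_cover_of_specs (X : finType) (g : nat)
    (K : @skeleton 'I_(size us) X (fun i => spec_half (nth_spec i))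
       (fun i => spec_right (nth_spec i))) :
  (#|se K| + G + 1 = g + size us + #|X|)%N ->
  size P = (G.*2 + \sum_(u <- us) size (spec_parts u))%N ->
  (forall b m, \sum_(e : se K) \sum_x
     [&& sep e (b (+) (flow e < 0)%R) == inr x & `|flow e|%N == m] =
     count (pred1 (b, m)) ends)%N ->
  exists phi : plmap R, zigzag_cover phi g (sumn lam) lam mu P.
Proof.
move=> gE sP cntE.
have [c cG] := cycle_distribution us_gt0 G_forked.
have ok i : spec_ok (nth_spec (us := us) i) by apply: (allP us_ok); exact: mem_tnth.
apply: (@zigzag_cover_of_skeleton _ _ _ _ _ K (fun i => spec_tail (nth_spec i) (c i))) => //.
- exact: Ordinal us_gt0.
- by move=> i; have /andP[] := ok i.
- by move=> i; exact: spec_tailP.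
- by rewrite cG gE card_ord.
- rewrite sP big_split /=.
  have -> : (\sum_i (tcyc (spec_tail (nth_spec i) (c i))).*2 = G.*2)%N.
    by rewrite -cG -muln2 big_distrl /=; apply: eq_bigr => i _; rewrite muln2.
  by rewrite big_tnth; congr (_ + _)%N; apply: eq_bigr => i _; rewrite spec_tail_parts.
- move=> b m; rewrite (specs_count typeE) cntE big_tnth; congr (_ + _)%N.
  by apply: eq_bigr => i _; rewrite spec_tail_parts.
Qed.

End SpecCovers.

Section StringCovers.
Variables (R : realType) (us : seq tail_spec) (lam mu : seq nat) (g : nat) (P : seq R).
Hypothesis us_ok : all spec_ok us.
Hypothesis sum_eq : sumn lam = sumn mu.
Hypothesis P_uniq : uniq P.
Hypothesis P_size : size P = (size lam + size mu + 2 * g - 2)%N.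

Lemma path_cover (e0 e1 : bool * nat) :
  specs_type us [:: e0; e1] lam mu -> odd e0.2 -> odd e1.2 -> (0 < size us)%N ->
  (1 < size us)%N \/ e0 != e1 -> (g == 0%N) || has spec_forked us ->
  exists phi : plmap R, zigzag_cover phi g (sumn lam) lam mu P.
Proof.
move=> typeE o0 o1 us_gt0 nf gf.
have fl : end_flow e0 + total_flow us + end_flow e1 = 0.
  have := specs_flow typeE sum_eq; rewrite !big_cons big_nil addr0 => <-.
  by rewrite addrCA addrA.
apply: (zigzag_cover_of_specs typeE us_ok us_gt0 gf P_uniq
  (K := path_skeleton o0 o1 fl nf)).
- by rewrite /= card_ord card_bool; lia.
- by rewrite P_size (specs_size typeE) /=; lia.
- by move=> b m; exact: path_leaf_count.
Qed.

(** The loop itself contributes one to the genus, so [g.-1] symmetric cycles remain for the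
    tails. *)
Lemma loop_cover :
  specs_type us [::] lam mu -> (2 < size us)%N -> (0 < g)%N ->
  (forall m, (0 < m < size us)%N -> 0 < total_flow (take m us)) ->
  has spec_forked us ->
  exists phi : plmap R, zigzag_cover phi g (sumn lam) lam mu P.
Proof.
move=> typeE us_gt2 g_gt0 fl_gt0 hf.
have fl : total_flow us = 0.
  by have := specs_flow typeE sum_eq; rewrite big_nil addr0.
have us_gt0 : (0 < size us)%N by exact: ltn_trans us_gt2.
have gf : (g.-1 == 0%N) || has spec_forked us by rewrite hf orbT.
apply: (zigzag_cover_of_specs typeE us_ok us_gt0 gf P_uniq
  (K := loop_skeleton us_gt2 fl fl_gt0)).
- by rewrite /= card_ord card_void; lia.
- by rewrite P_size (specs_size typeE) /=; lia.
- by move=> b m; apply: big1 => e _; apply: big1 => -[].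
Qed.

End StringCovers.

(** * From tail decompositions to lists of tails *)

Section Units.
Variable b : bool.

(** The parts of [2 s2e] and [2 s2o] are treated alike: a tail that is a single leaf may have any
    even weight. *)
Definition units (s2e s2o soo : seq nat) : seq tail_spec :=
  [seq (b, false, k) | k <- s2e ++ s2o] ++ [seq (b, true, k) | k <- soo].

Variables (s s2e s2o soo s0 : seq nat).
Hypothesis dec : tail_decomposition s s2e s2o soo s0.

Lemma units_ok : all spec_ok (units s2e s2o soo).
Proof.
have gt0 t : int_partition t -> all (fun k => 0 < k)%N t.
  by case/andP=> _ h; apply/allP => k kt; rewrite lt0n; apply: contraNneq h => <-.
have /and4P[/gt0 h1 /gt0 h2 /gt0 h3 _] := td_partitions dec.
rewrite all_cat !all_map; apply/andP; split; apply/allP => k /=.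
  rewrite mem_cat /spec_ok /= andbT => /orP[]; [exact: (allP h1)|exact: (allP h2)].
by move=> kt; rewrite /spec_ok /= (allP h3) // (allP (td_soo_odd dec)).
Qed.

Lemma units_right u : u \in units s2e s2o soo -> spec_right u = b.
Proof. by rewrite mem_cat => /orP[] /mapP[k _ ->]. Qed.

Lemma units_perm :
  perm_eq s (flatten [seq spec_parts u | u <- units s2e s2o soo] ++ s0).
Proof.
apply: (perm_trans (td_concat dec)); rewrite !catA perm_cat2r.
rewrite /units !map_cat !flatten_cat.
have E t : part_double t = flatten [seq spec_parts u | u <- [seq (b, false, k) | k <- t]].
  by elim: t => //= k t <-.
rewrite -!E perm_cat2l /part_square -map_comp.
by rewrite (eq_map (g := fun k => [:: k; k])).
Qed.

Lemma units_forked : has spec_forked (units s2e s2o soo) = (soo != [::]).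
Proof.
rewrite has_cat !has_map; case: soo => [|k t] /=; last by rewrite orbT.
by rewrite orbF; apply/hasPn.
Qed.

Lemma units_size : (size (units s2e s2o soo) + size s0 = 0 -> s = [::])%N.
Proof.
move=> h; apply/eqP; rewrite -size_eq0 (perm_size units_perm) size_cat.
by move: h; case: units => //=; case: s0.
Qed.

(** Each unit has even total weight and each part of [s0] is odd. Applied to both sides, this gives
    [size lam0] and [size mu0] the parity of [d]. *)
Lemma units_odd : odd (sumn s) = odd (size s0).
Proof.
rewrite (perm_sumn units_perm) sumn_cat oddD.
have -> : odd (sumn (flatten [seq spec_parts u | u <- units s2e s2o soo])) = false.
  elim: (units _ _ _) => //= u us IHus.
  by rewrite sumn_cat oddD IHus addbF /spec_parts; case: spec_forked;
    rewrite /= addn0 ?addnn odd_double.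
have := td_s0_odd dec; elim: (s0) => //= k t IHt /andP[ok ot].
by rewrite oddD ok -(IHt ot).
Qed.

End Units.

Lemma units_specs_type lam lam2e lam2o lamoo lam0 mu mu2e mu2o muoo mu0 :
  tail_decomposition lam lam2e lam2o lamoo lam0 ->
  tail_decomposition mu mu2e mu2o muoo mu0 ->
  specs_type (units false lam2e lam2o lamoo ++ units true mu2e mu2o muoo)
    ([seq (false, k) | k <- lam0] ++ [seq (true, k) | k <- mu0]) lam mu.
Proof.
move=> dl dm.
have U (b c : bool) (s1 s2 s3 : seq nat) :
   [seq u <- units b s1 s2 s3 | spec_right u == c] =
   if b == c then units b s1 s2 s3 else [::].
  case: eqP => [<-|bc].
    by apply/all_filterP/allP => u /units_right ->.
  rewrite -[RHS](filter_pred0 (units b s1 s2 s3)); apply: eq_in_filter => u /units_right ->.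
  exact/eqP.
have E (b c : bool) (t : seq nat) : [seq e.2 | e <- [seq (b, k) | k <- t] & e.1 == c] =
    if b == c then t else [::].
  elim: t => [|k t IHt] /=; first by case: (b == c).
  by case: (b == c) IHt => /= ->.
by case; rewrite filter_cat !U filter_cat /= [X in _ ++ X]map_cat !E /= ?cats0;
  exact: units_perm.
Qed.

Lemma specs_type_perm us us' ends ends' lam mu :
  perm_eq us us' -> perm_eq ends ends' ->
  specs_type us ends lam mu -> specs_type us' ends' lam mu.
Proof.
move=> pu pe H b; apply: (perm_trans (H b)); apply: perm_cat.
  by apply/perm_flatten/perm_map/perm_filter.
by apply/perm_map/perm_filter.
Qed.

(** Trades a forked tail for the two ends of a string, with the same leaves [k, k] on the same
    side. *)
Lemma specs_type_fork b k us lam mu :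
  specs_type ((b, true, k) :: us) [::] lam mu ->
  specs_type us [:: (b, k); (b, k)] lam mu.
Proof.
move=> H c; apply: (perm_trans (H c)) => /=; rewrite cats0.
rewrite {1}/spec_right /=; case: (b == c) => /=; last by rewrite cats0.
by rewrite perm_sym -[X in perm_eq _ X]/([:: k; k] ++ _) perm_catC.
Qed.

(** * Existence *)

Lemma total_flow_side (b : bool) us : us != [::] -> all spec_ok us ->
  {in us, forall u, spec_right u = b} ->
  if b then total_flow us < 0 else 0 < total_flow us.
Proof.
have flow1 u : spec_ok u -> spec_right u = b ->
    if b then spec_flow u < 0 else 0 < spec_flow u.
  by rewrite /spec_flow => /andP[k0 _] ->; case: (b); rewrite ?oppr_lt0 ltz_nat double_gt0.
elim: us => // u us IHus _ /= /andP[uok usok] ub.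
have := flow1 u uok (ub u (mem_head _ _)).
have [->|nz] := eqVneq us [::]; first by rewrite /total_flow big_seq1.
have usb : {in us, forall v, spec_right v = b}.
  by move=> v vus; apply: ub; rewrite inE vus orbT.
have := IHus nz usok usb.
have -> : total_flow (u :: us) = spec_flow u + total_flow us by exact: big_cons.
by move: (total_flow us) (spec_flow u) => x y; case: (b); lia.
Qed.

Lemma cat_total_flow us vs : total_flow (us ++ vs) = total_flow us + total_flow vs.
Proof. exact: big_cat. Qed.

(** A prefix within [us] sums positive terms only. A longer prefix is minus the remaining suffix,
    since the total is 0, and that suffix is a nonempty list of tails on the right, with negative
    sum. *)
Lemma total_flow_take_gt0 us vs m :
  all spec_ok us -> all spec_ok vs ->
  {in us, forall u, spec_right u = false} -> {in vs, forall u, spec_right u = true} ->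
  total_flow (us ++ vs) = 0 -> (0 < m < size (us ++ vs))%N ->
  0 < total_flow (take m (us ++ vs)).
Proof.
move=> uok vok ub vb sum0 /andP[m0 ms].
rewrite size_cat in ms; rewrite take_cat; case: ltnP => mus.
  apply: (total_flow_side (b := false)).
  - by rewrite -size_eq0 size_takel ?(ltnW mus) // -lt0n.
  - by apply/allP => u /mem_take; exact: (allP uok).
  - by move=> u /mem_take; exact: ub.
have := sum0; rewrite -[in X in X = 0 -> _](cat_take_drop (m - size us) vs) catA.
rewrite [in X in X -> _]cat_total_flow => /eqP; rewrite addr_eq0 => /eqP ->.
rewrite oppr_gt0; apply: (total_flow_side (b := true)).
- by rewrite -size_eq0 size_drop -lt0n subn_gt0 ltn_subLR.
- by apply/allP => u /mem_drop; exact: (allP vok).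
- by move=> u /mem_drop; exact: vb.
Qed.

(** This is the source of the excluded types: a side consisting of one unit is [(2k)] or
    [(k, k)]. *)
Lemma single_unit_type (b : bool) s s2e s2o soo u :
  tail_decomposition s s2e s2o soo [::] -> units b s2e s2o soo = [:: u] ->
  s \in [:: [:: (2 * spec_half u)%N]; [:: spec_half u; spec_half u]].
Proof.
move=> dec uE; have := units_perm b dec; rewrite uE /= !cats0.
rewrite /spec_parts !inE mul2n; case: spec_forked => h.
  have : size s = 2%N by rewrite (perm_size h).
  case: s dec h => [|x [|y []]] //= dec h _.
  have := perm_mem h x; have := perm_mem h y; rewrite !inE !eqxx !orbT.
  by rewrite !orbb /= => /esym/eqP -> /esym/eqP ->; rewrite eqxx orbT.
have : size s = 1%N by rewrite (perm_size h).
case: s dec h => [|x []] //= dec h _.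
by have := perm_mem h x; rewrite !inE eqxx => /esym/eqP ->; rewrite eqxx.
Qed.

Theorem proposition5p2 (R : realType) (g d r : nat) (lam mu : seq nat)
    (lam2e lam2o lamoo lam0 mu2e mu2o muoo mu0 : seq nat) (P : seq R) :
  (0 < d)%N ->
  partition_of d lam -> partition_of d mu ->
  r = (size lam + size mu + 2 * g - 2)%N -> (0 < r)%N ->
  (forall k : nat, (1 <= k)%N ->
     ~ ({subset [:: lam; mu] <= [:: [:: (2 * k)%N]; [:: k; k]]})) ->
  tail_decomposition lam lam2e lam2o lamoo lam0 ->
  tail_decomposition mu mu2e mu2o muoo mu0 ->
  uniq P -> size P = r ->
  (size (lam0 ++ mu0) <= 2)%N ->
  lamoo ++ muoo <> [::] ->
  (exists phi : plmap R, zigzag_cover phi g d lam mu P) /\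
  (0%:E < zigzag_number g d lam mu P)%E.
Proof.
move=> d_gt0 /andP[_ /eqP lamE] /andP[_ /eqP muE] rE _ excl declam decmu P_uniq.
rewrite rE => P_size size0 oo.
suff [phi phiP] : exists phi : plmap R, zigzag_cover phi g d lam mu P.
  split; first by exists phi.
  apply: (@lt_le_trans _ _ (1%:R%:E)); first by rewrite lte_fin ltr01.
  apply: ereal_sup_ubound; exists 1%N => //=; exists (fun=> phi); split=> //.
  by move=> i j; rewrite !ord1 eqxx.
pose ul := units false lam2e lam2o lamoo; pose um := units true mu2e mu2o muoo.
pose us := ul ++ um.
pose ends := [seq (false, k) | k <- lam0] ++ [seq (true, k) | k <- mu0].
have typeE : specs_type us ends lam mu by exact: units_specs_type.
have sum_eq : sumn lam = sumn mu by rewrite lamE muE.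
have ul_ok : all spec_ok ul := units_ok false declam.
have um_ok : all spec_ok um := units_ok true decmu.
have us_ok : all spec_ok us by rewrite all_cat ul_ok um_ok.
have us_forked : has spec_forked us.
  move: oo; apply: contra_notT; rewrite has_cat !units_forked negb_or !negbK.
  by move=> /andP[/eqP -> /eqP ->].
have us_gt0 : (0 < size us)%N.
  by move: us_forked; rewrite lt0n size_eq0; apply: contraTneq => ->.
have size_ends : size ends = (size lam0 + size mu0)%N by rewrite size_cat !size_map.
rewrite size_cat in size0.
rewrite -lamE.
(* The two sizes have equal parity, so their sum is even, and it is at most 2. *)
have [ends0|ends2] : size ends = 0%N \/ size ends = 2%N.
  have := units_odd false declam; rewrite lamE -muE (units_odd true decmu).
  by rewrite size_ends; lia.
- have lam00 : lam0 = [::] by apply: size0nil; lia.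
  have mu00 : mu0 = [::] by apply: size0nil; lia.
  subst lam0 mu0.
  (* As [d] is positive, both sides have a unit. Two units in all would mean one on each side, which
     is an excluded type. *)
  have us_gt2 : (2 < size us)%N.
    have ul0 : size ul != 0%N.
      apply: contraTneq d_gt0 => ul0; rewrite -lamE.
      by rewrite (units_size (b := false) declam) // addn0.
    have um0 : size um != 0%N.
      apply: contraTneq d_gt0 => um0; rewrite -muE.
      by rewrite (units_size (b := true) decmu) // addn0.
    rewrite ltnNge; apply/negP; rewrite size_cat => le2.
    have size1 (t : seq tail_spec) : size t = 1%N -> exists u, t = [:: u].
      by case: t => [|u []] // _; exists u.
    have [|u ulE] := size1 ul; first by move: ul0 um0 le2; lia.
    have [|v umE] := size1 um; first by move: ul0 um0 le2; lia.
    have lamT := single_unit_type declam ulE.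
    have muT := single_unit_type decmu umE.
    (* In either form the parts of a one-unit side add up to twice its half, and both sums are
       [d]. *)
    have uv : spec_half u = spec_half v.
      move: lamT muT lamE muE; rewrite !inE.
      by move=> /orP[]/eqP -> /orP[]/eqP -> /=; lia.
    have u_gt0 : (0 < spec_half u)%N.
      by move: ul_ok; rewrite ulE /= andbT => /andP[].
    apply: (excl _ u_gt0) => s; rewrite !inE => /orP[]/eqP ->; first by move: lamT; rewrite !inE.
    by move: muT; rewrite uv !inE.
  have [g0|g_gt0] := posnP g.
    have /hasP[u uus uf] := us_forked.
    have uE : u = (spec_right u, true, spec_half u).
      by move: uf; rewrite /spec_forked; case: (u) => [[b f] k] /= ->.
    have pus := perm_to_rem uus.
    apply: (@path_cover _ (rem u us) lam mu g P _ _ _ _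
      (spec_right u, spec_half u) (spec_right u, spec_half u)) => //.
    + by apply/allP => v /mem_rem; exact: (allP us_ok).
    + apply: specs_type_fork; rewrite -uE.
      by apply: specs_type_perm typeE.
    + by move: (allP us_ok _ uus) => /andP[_]; rewrite uf.
    + by move: (allP us_ok _ uus) => /andP[_]; rewrite uf.
    + by rewrite size_rem // -subn1 subn_gt0 ltnW.
    (* The two ends are equal here, so the fork must be avoided by a second tail: at least two
       remain after [u] is removed. *)
    + by left; rewrite size_rem // -subn1 ltn_subRL.
    + by rewrite g0.
  apply: (@loop_cover _ us) => //.
  move=> m; apply: total_flow_take_gt0 => //.
  + exact: units_right.
  + exact: units_right.
  + by have := specs_flow typeE sum_eq; rewrite big_nil addr0.
- have ends_odd e : e \in ends -> odd e.2.
    by rewrite mem_cat => /orP[] /mapP[k k0 ->] /=;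
      [exact: (allP (td_s0_odd declam))|exact: (allP (td_s0_odd decmu))].
  (* Ends on the same side differ in weight and ends on different sides differ in side, so even a
     single tail gives no symmetric fork. *)
  have ends_uniq : uniq ends.
    rewrite cat_uniq !map_inj_uniq ?(td_s0_uniq declam) ?(td_s0_uniq decmu) //.
    - rewrite andbT /=; apply/hasPn => e /mapP[k _ ->].
      by apply/mapP => -[k' _].
    - by move=> x y [].
    - by move=> x y [].
  have [e0 [e1 endsE]] : exists e0 e1, ends = [:: e0; e1].
    by move: ends2; case: (ends) => [|e0 [|e1 []]] // _; exists e0, e1.
  rewrite endsE in ends_odd ends_uniq typeE.
  apply: (path_cover us_ok sum_eq P_uniq P_size typeE) => //.
  + by apply: ends_odd; rewrite mem_head.
  + by apply: ends_odd; rewrite !inE eqxx orbT.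
  + by right; move: ends_uniq; rewrite /= !inE andbT.
  + by rewrite us_forked orbT.
Qed.
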